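(* Let $(X,D)=(\mathbb{C},\{0\})$ and let $\pi_0:M_0\to\mathbb{C}$ be the surjective holomorphic map, with $\mathbb{C}^*$-action on $M_0$, defined in the context. Then the sheaf on $\mathbb{C}$ of automorphisms of $(M_0,\pi_0)$ respecting the $\mathbb{C}^*$-action on $M_0$ is given by $\mathcal{O}_X^\times( *D)$.
   Context: Construction of $(M_0,\pi_0)$: let $(\mathbb{C}^2_i)_{i\in\mathbb{Z}}$ be a family of affine planes with coordinates $(x_i,y_i)$, and let $\sim$ be the equivalence relation on $\coprod_{i\in\mathbb{Z}}\mathbb{C}^2_i$ generated by $(x_{i+1},y_{i+1})=(y_i^{-1},y_i^2x_i)$ for $y_i\ne0$. Let $M_0=\left(\coprod_{i\in\mathbb{Z}}\mathbb{C}^2_i\right)/\sim$, a smooth complex surface. The map $\pi_0:M_0\to\mathbb{C}$ is $(x_i,y_i)\mapsto x_iy_i$, and the $\mathbb{C}^*$-action is $\lambda\cdot(x_i,y_i)=(\lambda x_i,\lambda^{-1}y_i)$; both are compatible with $\sim$, and the action preserves $\pi_0$. The sheaf of automorphisms assigns to an open $V\subset\mathbb{C}$ the group of $\mathbb{C}^*$-equivariant biholomorphisms of $\pi_0^{-1}(V)$ commuting with $\pi_0$. $\mathcal{O}_X^\times( *D)$ is the sheaf of invertible elements in the sheaf of meromorphic functions with poles only on $D$; near $0$ its sections are $hz^k$ with $h$ holomorphic and nonvanishing, $k\in\mathbb{Z}$. The identification is as sheaves of groups. *)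

(* Defs.v *)
From HB Require Import structures.
From Stdlib Require Import Relation_Operators.
From mathcomp Require Import all_boot all_order all_algebra complex.
From mathcomp Require Import all_classical all_reals all_analysis.

Set Implicit Arguments.
Unset Strict Implicit.
Unset Printing Implicit Defensive.

Import Order.TTheory GRing.Theory Num.Theory numFieldNormedType.Exports.
Local Open Scope classical_set_scope.
Local Open Scope ring_scope.

Record opens (T : topologicalType) := Opens {
  open_set :> set T;
  openP : open open_set
}.

Lemma opens_capP (T : topologicalType) (U V : opens T) : open (U `&` V).
Proof. exact: openI (openP U) (openP V). Qed.

Definition opens_cap (T : topologicalType) (U V : opens T) : opens T :=
  Opens (opens_capP U V).

Definition compatible (T : topologicalType) (F : opens T -> groupType)
    (res : forall U V : opens T, U `<=` V -> F V -> F U)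
    (I : Type) (U : I -> opens T) (s : forall i, F (U i)) :=
  forall (i j : I) (W : opens T) (Wi : W `<=` U i) (Wj : W `<=` U j),
    res W (U i) Wi (s i) = res W (U j) Wj (s j).

Definition sheaf_axiom (T : topologicalType) (F : opens T -> groupType)
    (res : forall U V : opens T, U `<=` V -> F V -> F U) :=
  forall (V : opens T) (I : Type) (U : I -> opens T)
         (UV : forall i, U i `<=` V),
    V `<=` \bigcup_i U i ->
    forall s : (forall i, F (U i)), compatible res s ->
      exists! t : F V, forall i, res (U i) V (UV i) t = s i.

Record group_sheaf (T : topologicalType) := GroupSheaf {
  sections :> opens T -> groupType;
  restr : forall U V : opens T, U `<=` V -> sections V -> sections U;
  restrM : forall (U V : opens T) (UV : U `<=` V),
    {morph restr UV : s t / (s * t)%g};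
  restr_id : forall (U : opens T) (UU : U `<=` U), restr UU =1 id;
  restr_comp : forall (U V W : opens T)
      (UV : U `<=` V) (VW : V `<=` W) (UW : U `<=` W),
    restr UV \o restr VW =1 restr UW;
  sheafP : sheaf_axiom restr
}.

Definition sheaf_isomorphic (T : topologicalType) (F G : group_sheaf T) :=
  exists phi : forall U : opens T, F U -> G U,
    [/\ forall U, {morph phi U : s t / (s * t)%g},
        forall U, bijective (phi U) &
        forall (U V : opens T) (UV : U `<=` V) (s : F V),
          restr UV (phi V s) = phi U (restr UV s)].

Lemma glue_fun (X S I : Type) (A : I -> set X) (B : set X)
    (AB : forall i, A i `<=` B) (f : forall i, A i -> S) :
  B `<=` \bigcup_i A i ->
  (forall i j (x : A i) (y : A j), \val x = \val y -> f i x = f j y) ->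
  exists F : B -> S, forall i (x : A i), F (subfun (AB i) x) = f i x.
Proof.
move=> cov fE.
have idx (b : B) : {i & A i (\val b)}.
  by apply: cid; have [i _ Ai] := cov _ (set_valP b); exists i.
exists (fun b => f (projT1 (idx b))
  (SigSub (mem_set (projT2 (idx b)) : \val b \in A (projT1 (idx b))))).
by move=> i x; exact: fE.
Qed.

Definition CC (R : realType) : numClosedFieldType := R[i].

Definition holomorphic_at (K : numDomainType) (U V : normedModType K)
    (f : U -> V) (x : U) :=
  \forall y \near x, differentiable f y.

Section HolomorphicAt.
Variables (K : numFieldType) (U V W : normedModType K).

Lemma holomorphic_at_near (g : U -> V) (x : U) (P : V -> Prop) :
  holomorphic_at g x -> (\forall y \near g x, P y) -> \forall y \near x, P (g y).
Proof.
move=> hg nP; have cg := differentiable_continuous (nbhs_singleton hg).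
exact: cg _ nP.
Qed.

Lemma holomorphic_at_comp (f : V -> W) (g : U -> V) (x : U) :
  holomorphic_at g x -> holomorphic_at f (g x) -> holomorphic_at (f \o g) x.
Proof.
move=> hg hf; have hfg := holomorphic_at_near hg hf.
by move: hg hfg; apply: filterS2 => y; exact: differentiable_comp.
Qed.

End HolomorphicAt.

Section MeromorphicUnits.
Variable R : realType.
Local Notation C := (CC R).
Implicit Types U V W : opens C.

(* A meromorphic function on V with poles only on D = {0} is encoded by its
   values on V \ D: it is holomorphic there, and has the form h / z^n near 0,
   with h holomorphic at 0, when 0 is in V. *)
Definition meromorphic V (f : (V `\ 0 : set C) -> C) :=
  (forall z : (V `\ 0 : set C), exists2 g : C -> C, holomorphic_at g (\val z) &
     \forall w \near \val z, forall w' : (V `\ 0 : set C),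
       \val w' = w -> f w' = g w) /\
  (open_set V 0 -> exists (n : nat) (h : C -> C), holomorphic_at h 0 /\
     \forall w \near (0 : C), forall w' : (V `\ 0 : set C),
       \val w' = w -> f w' = h w / w ^+ n).

Definition meromorphic_unit V (f : (V `\ 0 : set C) -> C) :=
  meromorphic f /\ exists2 g, meromorphic g & forall z, f z * g z = 1.

Record mero_unit V := MeroUnit {
  mero_fun :> (V `\ 0 : set C) -> C;
  mero_unitP : meromorphic_unit mero_fun
}.

HB.instance Definition _ V := gen_eqMixin (mero_unit V).
HB.instance Definition _ V := gen_choiceMixin (mero_unit V).

Lemma mero_unit_ext V (f g : mero_unit V) : f =1 g -> f = g.
Proof.
case: f g => [f fP] [g gP] /= /funext fg; rewrite fg in fP *.
by congr MeroUnit; exact: Prop_irrelevance.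
Qed.

Lemma meromorphic1 V : @meromorphic V (fun=> 1).
Proof.
split=> [z|_]; first by exists (fun=> 1); near=> w.
exists 0%N, (fun=> 1); split; first by near=> w.
by near=> w => w' _; rewrite expr0 divr1.
Unshelve. all: by end_near. Qed.

Lemma meromorphicM V (f g : (V `\ 0 : set C) -> C) :
  meromorphic f -> meromorphic g -> meromorphic (fun z => f z * g z).
Proof.
move=> [f1 f2] [g1 g2]; split=> [z|V0].
  have [a ha fa] := f1 z; have [b hb gb] := g1 z.
  exists (a * b : C -> C).
    by move: ha hb; apply: filterS2 => w; exact: differentiableM.
  by move: fa gb; apply: filterS2 => w fw gw w' ww'; rewrite (fw _ ww') (gw _ ww').
have [m [a [ha fa]]] := f2 V0; have [n [b [hb gb]]] := g2 V0.
exists (m + n)%N, (a * b : C -> C); split.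
  by move: ha hb; apply: filterS2 => w; exact: differentiableM.
move: fa gb; apply: filterS2 => w fw gw w' ww'.
by rewrite (fw _ ww') (gw _ ww') exprD invfM mulrACA.
Qed.

Lemma meromorphic_unit1 V : @meromorphic_unit V (fun=> 1).
Proof.
split; first exact: meromorphic1.
by exists (fun=> 1) => [|z]; [exact: meromorphic1|rewrite mulr1].
Qed.

Lemma meromorphic_unitM V (f g : mero_unit V) :
  meromorphic_unit (fun z => f z * g z).
Proof.
have [fm [f' f'm ff']] := mero_unitP f; have [gm [g' g'm gg']] := mero_unitP g.
split; first exact: meromorphicM.
exists (fun z => f' z * g' z) => [|z]; first exact: meromorphicM.
by rewrite mulrACA ff' gg' mulr1.
Qed.

Lemma mero_unit_neq0 V (f : mero_unit V) z : f z != 0.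
Proof.
have [_ [g _ /(_ z) fg]] := mero_unitP f.
by apply/eqP => f0; move: fg; rewrite f0 mul0r => /esym/eqP; rewrite oner_eq0.
Qed.

Lemma meromorphic_unitV V (f : mero_unit V) :
  meromorphic_unit (fun z => (f z)^-1).
Proof.
have [fm [g gm fg]] := mero_unitP f.
have -> : (fun z => (f z)^-1) = g.
  apply/funext => z; rewrite -[LHS]mulr1 -(fg z) mulKf //.
  exact: mero_unit_neq0.
by split=> //; exists f => // z; rewrite mulrC.
Qed.

Definition mero_unit_one V := MeroUnit (@meromorphic_unit1 V).
Definition mero_unit_mul V (f g : mero_unit V) := MeroUnit (meromorphic_unitM f g).
Definition mero_unit_inv V (f : mero_unit V) := MeroUnit (meromorphic_unitV f).

Lemma mero_unit_mulA V : associative (@mero_unit_mul V).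
Proof. by move=> f g h; apply: mero_unit_ext => z /=; rewrite mulrA. Qed.

Lemma mero_unit_mul1 V : left_id (mero_unit_one V) (@mero_unit_mul V).
Proof. by move=> f; apply: mero_unit_ext => z /=; rewrite mul1r. Qed.

Lemma mero_unit_mulr1 V : right_id (mero_unit_one V) (@mero_unit_mul V).
Proof. by move=> f; apply: mero_unit_ext => z /=; rewrite mulr1. Qed.

Lemma mero_unit_mulV V :
  left_inverse (mero_unit_one V) (@mero_unit_inv V) (@mero_unit_mul V).
Proof.
by move=> f; apply: mero_unit_ext => z /=; rewrite mulVf // mero_unit_neq0.
Qed.

Lemma mero_unit_mulrV V :
  right_inverse (mero_unit_one V) (@mero_unit_inv V) (@mero_unit_mul V).
Proof.
by move=> f; apply: mero_unit_ext => z /=; rewrite mulfV // mero_unit_neq0.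
Qed.

HB.instance Definition _ V := isGroup.Build (mero_unit V)
  (@mero_unit_mulA V) (@mero_unit_mul1 V) (@mero_unit_mulr1 V)
  (@mero_unit_mulV V) (@mero_unit_mulrV V).

Lemma subpunct U V : U `<=` V -> (U `\ 0 : set C) `<=` V `\ 0.
Proof. by move=> UV; exact: setSD. Qed.

Lemma meromorphic_restr U V (UV : U `<=` V) (f : (V `\ 0 : set C) -> C) :
  meromorphic f -> meromorphic (f \o subfun (subpunct UV)).
Proof.
move=> [f1 f2]; split=> [z|U0].
  have [g hg fg] := f1 (subfun (subpunct UV) z).
  by exists g => //; move: fg; apply: filterS => w fw w' ww' /=; exact: fw.
have [n [h [hh fh]]] := f2 (UV _ U0); exists n, h; split=> //.
by move: fh; apply: filterS => w fw w' ww' /=; exact: fw.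
Qed.

Lemma meromorphic_unit_restr U V (UV : U `<=` V) (f : mero_unit V) :
  meromorphic_unit (f \o subfun (subpunct UV)).
Proof.
have [fm [g gm fg]] := mero_unitP f; split; first exact: meromorphic_restr.
exists (g \o subfun (subpunct UV)) => [|z]; first exact: meromorphic_restr.
exact: fg.
Qed.

Definition mero_restr U V (UV : U `<=` V) (f : mero_unit V) : mero_unit U :=
  MeroUnit (meromorphic_unit_restr UV f).

Lemma mero_restrM U V (UV : U `<=` V) :
  {morph mero_restr UV : f g / (f * g)%g}.
Proof. by move=> f g; exact: mero_unit_ext. Qed.

Lemma mero_restr_id U (UU : U `<=` U) : mero_restr UU =1 id.
Proof.
move=> f; apply: mero_unit_ext => z /=.
by congr (mero_fun f _); exact: val_inj.
Qed.

Lemma mero_restr_comp U V W (UV : U `<=` V) (VW : V `<=` W) (UW : U `<=` W) :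
  mero_restr UV \o mero_restr VW =1 mero_restr UW.
Proof.
move=> f; apply: mero_unit_ext => z /=.
by congr (mero_fun f _); exact: val_inj.
Qed.

Lemma punct_cover V (I : Type) (U : I -> opens C) :
  V `<=` \bigcup_i U i -> (V `\ 0 : set C) `<=` \bigcup_i (U i `\ 0).
Proof. by move=> cov z [/cov[i _ Uiz] z0]; exists i. Qed.

Lemma meromorphic_local V (I : Type) (U : I -> opens C)
    (UV : forall i, U i `<=` V) (f : (V `\ 0 : set C) -> C) :
  V `<=` \bigcup_i U i ->
  (forall i, meromorphic (f \o subfun (subpunct (UV i)))) -> meromorphic f.
Proof.
move=> cov fm; split=> [z|V0].
  have [i _ Uiz] := punct_cover cov (set_valP z).
  have [+ _] := fm i.
  move=> /(_ (SigSub (mem_set Uiz))) [g hg fg]; exists g => //.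
  have : \forall w \near (\val z : C), open_set (U i) w.
    by apply: open_nbhs_nbhs; split; [exact: openP|exact: Uiz.1].
  move: fg; apply: filterS2 => w /= fw Uiw w' ww'.
  have Uiw' : (U i `\ 0) w by split=> //; rewrite -ww'; exact: (set_valP w').2.
  rewrite -(fw (SigSub (mem_set Uiw')) erefl).
  by congr f; exact: val_inj.
have [i _ Ui0] := cov _ V0.
have [_ /(_ Ui0)[n [h [hh fh]]]] := fm i; exists n, h; split=> //.
have : \forall w \near (0 : C), open_set (U i) w.
  by apply: open_nbhs_nbhs; split=> //; exact: openP.
move: fh; apply: filterS2 => w /= fw Uiw w' ww'.
have Uiw' : (U i `\ 0) w by split=> //; rewrite -ww'; exact: (set_valP w').2.
rewrite -(fw (SigSub (mem_set Uiw')) erefl).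
by congr f; exact: val_inj.
Qed.

Lemma mero_compatE (I : Type) (U : I -> opens C)
    (s : forall i, mero_unit (U i)) : compatible mero_restr s ->
  forall i j (x : (U i `\ 0 : set C)) (y : (U j `\ 0 : set C)),
    \val x = \val y -> s i x = s j y.
Proof.
move=> cs i j x y xy; pose W := opens_cap (U i) (U j).
have Wi : W `<=` U i by move=> ? [].
have Wj : W `<=` U j by move=> ? [].
have Wx : (W `\ 0) (\val x).
  have [Ux x0] := set_valP x; have [Uy _] := set_valP y.
  by split=> //; split=> //; rewrite xy.
have := congr1 (fun f => mero_fun f (SigSub (mem_set Wx))) (cs i j W Wi Wj).
rewrite /=; set a := subfun _ _; set b := subfun _ _.
have -> : a = x by exact: val_inj.
have -> : b = y by exact: val_inj.
exact: id.
Qed.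

Lemma mero_sheaf_axiom : sheaf_axiom mero_restr.
Proof.
move=> V I U UV cov s cs.
pose UV0 i := subpunct (UV i).
have [F FE] : exists F : (V `\ 0 : set C) -> C,
    forall i x, F (subfun (UV0 i) x) = s i x.
  exact: glue_fun (punct_cover cov) (mero_compatE cs).
have [G GE] : exists G : (V `\ 0 : set C) -> C,
    forall i x, G (subfun (UV0 i) x) = (s i x)^-1.
  apply: glue_fun (punct_cover cov) _ => i j x y xy.
  by rewrite (mero_compatE cs xy).
have Fm : meromorphic F.
  apply: (meromorphic_local cov) => i.
  rewrite (_ : F \o _ = s i); first exact: (mero_unitP (s i)).1.
  by apply/funext => x /=; exact: FE.
have Gm : meromorphic G.
  apply: (meromorphic_local cov) => i.
  rewrite (_ : G \o _ = mero_unit_inv (s i)).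
    exact: (mero_unitP (mero_unit_inv _)).1.
  by apply/funext => x /=; exact: GE.
have surj (z : (V `\ 0 : set C)) : exists i x, z = subfun (UV0 i) x.
  have [i _ Uiz] := punct_cover cov (set_valP z).
  by exists i, (SigSub (mem_set Uiz)); exact: val_inj.
have FGm : meromorphic_unit F.
  split=> //; exists G => // z; have [i [x ->]] := surj z.
  by rewrite FE GE mulfV // mero_unit_neq0.
exists (MeroUnit FGm); split=> [i|t tE].
  by apply: mero_unit_ext => x /=; exact: FE.
apply: mero_unit_ext => z /=; have [i [x ->]] := surj z.
by rewrite FE -(tE i).
Qed.

Definition mero_unit_sheaf : group_sheaf C :=
  GroupSheaf mero_restrM mero_restr_id mero_restr_comp mero_sheaf_axiom.

End MeromorphicUnits.

Section Surface.
Variable R : realType.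
Local Notation C := (CC R).
Implicit Types U V W : opens C.

(* (i, (x, y)) stands for the point (x, y) of the i-th copy of the plane. *)
Definition planes : Type := (int * (C * C))%type.
HB.instance Definition _ := Choice.on planes.

Definition glue (p q : planes) : Prop :=
  let: (i, (x, y)) := p in y != 0 /\ q = (i + 1, (y^-1, y ^+ 2 * x)).

Definition glue_equiv : rel planes :=
  fun p q => `[< clos_refl_sym_trans _ glue p q >].

Lemma glue_equiv_refl : reflexive glue_equiv.
Proof. by move=> p; apply/asboolP; exact: rst_refl. Qed.

Lemma glue_equiv_sym : symmetric glue_equiv.
Proof. by move=> p q; apply/asboolP/asboolP; exact: rst_sym. Qed.

Lemma glue_equiv_trans : transitive glue_equiv.
Proof.
by move=> q p r /asboolP pq /asboolP qr; apply/asboolP; exact: rst_trans pq qr.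
Qed.

Canonical glue_equiv_rel :=
  EquivRel glue_equiv glue_equiv_refl glue_equiv_sym glue_equiv_trans.

Definition M0 : Type := {eq_quot glue_equiv}%qT.
HB.instance Definition _ := EqQuotient.on M0.

Definition chart (i : int) (p : C * C) : M0 := (\pi_M0 (i, p))%qT.

(* [pi0] and [act] are read on a representative; see [pi0_chart], [act_chart].
   [act] is the action of C^x, and is only meaningful for l != 0. *)
Definition pi0 (m : M0) : C := let: (_, (x, y)) := repr m in x * y.

Definition act (l : C) (m : M0) : M0 :=
  let: (i, (x, y)) := repr m in chart i (l * x, l^-1 * y).

Lemma chart_surj m : exists i p, m = chart i p.
Proof.
by exists (repr m).1, (repr m).2; rewrite /chart -surjective_pairing reprK.
Qed.

Lemma chart_glue i x y : y != 0 -> chart i (x, y) = chart (i + 1) (y^-1, y ^+ 2 * x).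
Proof.
by move=> y0; apply/eqmodP/asboolP; apply: rst_step; split.
Qed.

Lemma planes_ind2 (S : Type) (f : planes -> S) (p q : planes) :
  (forall p q, glue p q -> f p = f q) -> glue_equiv p q -> f p = f q.
Proof.
move=> fE /asboolP; elim=> {p q} [p q /fE//|//|p q _ ->//|p q r _ -> _ ->//].
Qed.

Lemma glue_repr i p : glue_equiv (repr (chart i p)) (i, p).
Proof. by apply/eqmodP; rewrite reprK. Qed.

Lemma pi0_chart i x y : pi0 (chart i (x, y)) = x * y.
Proof.
pose f (p : planes) := p.2.1 * p.2.2.
have -> m : pi0 m = f (repr m) by rewrite /pi0 /f; case: (repr m) => ? [].
rewrite -[RHS]/(f (i, (x, y))); apply: planes_ind2 (glue_repr _ _).
move=> [j [a b]] q [b0 ->]; rewrite /f /=.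
by rewrite expr2 -mulrA mulKf // mulrC.
Qed.

Lemma act_chart l i x y : l != 0 ->
  act l (chart i (x, y)) = chart i (l * x, l^-1 * y).
Proof.
move=> l0; pose f (p : planes) := chart p.1 (l * p.2.1, l^-1 * p.2.2).
have -> m : act l m = f (repr m) by rewrite /act /f; case: (repr m) => ? [].
rewrite -[RHS]/(f (i, (x, y))); apply: planes_ind2 (glue_repr _ _).
move=> [j [a b]] q [b0 ->]; rewrite /f /= chart_glue ?mulf_neq0 ?invr_eq0 //.
congr (chart _ (_, _)); first by rewrite invfM invrK.
rewrite exprMn -mulrA [b ^+ 2 * (l * a)]mulrCA [l^-1 ^+ 2]expr2 -mulrA.
by rewrite (mulKf l0).
Qed.

Lemma pi0_act l m : l != 0 -> pi0 (act l m) = pi0 m.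
Proof.
move=> l0; have [i [[x y] ->]] := chart_surj m.
by rewrite act_chart // !pi0_chart mulrACA mulfV // mul1r.
Qed.

Lemma act1 m : act 1 m = m.
Proof.
have [i [[x y] ->]] := chart_surj m.
by rewrite act_chart ?oner_eq0 // invr1 !mul1r.
Qed.

Lemma actM k l m : k != 0 -> l != 0 -> act (k * l) m = act k (act l m).
Proof.
move=> k0 l0; have [i [[x y] ->]] := chart_surj m.
by rewrite !act_chart ?mulf_neq0 // invfM !mulrA.
Qed.

Lemma pi0_surj z : exists m, pi0 m = z.
Proof. by exists (chart 0 (z, 1)); rewrite pi0_chart mulr1. Qed.

(* The complex structure of M0 is the one for which every [chart i] is an open
   holomorphic embedding.  A map between open subsets is holomorphic if near
   each point it is given in charts by a map g that is complex differentiable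
   on a neighbourhood; continuity of f follows from that of g. *)
Definition holomorphicM0 (A B : set M0) (f : A -> B) :=
  forall (a : A) (i : int) (p : C * C), \val a = chart i p ->
    exists (j : int) (g : C * C -> C * C), holomorphic_at g p /\
      \forall q \near p, forall b : A,
        \val b = chart i q -> \val (f b) = chart j (g q).

Definition biholomorphicM0 (A B : set M0) (f : A -> B) :=
  holomorphicM0 f /\
  exists g : B -> A, [/\ holomorphicM0 g, cancel f g & cancel g f].

Definition equivariant (A : set M0) (f : A -> A) :=
  forall (l : C) (a b : A), l != 0 ->
    \val b = act l (\val a) -> \val (f b) = act l (\val (f a)).

Definition over_pi0 (A : set M0) (f : A -> A) :=
  forall a : A, pi0 (\val (f a)) = pi0 (\val a).

Definition is_aut V (f : (pi0 @^-1` V : set M0) -> (pi0 @^-1` V : set M0)) :=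
  [/\ biholomorphicM0 f, equivariant f & over_pi0 f].

Record aut V := Aut {
  aut_fun :> (pi0 @^-1` V : set M0) -> (pi0 @^-1` V : set M0);
  autP : is_aut aut_fun
}.

HB.instance Definition _ V := gen_eqMixin (aut V).
HB.instance Definition _ V := gen_choiceMixin (aut V).

Lemma aut_ext V (f g : aut V) : f =1 g -> f = g.
Proof.
case: f g => [f fP] [g gP] /= /funext fg; rewrite fg in fP *.
by congr Aut; exact: Prop_irrelevance.
Qed.

Lemma holomorphicM0_id (A : set M0) : @holomorphicM0 A A id.
Proof.
move=> a i p ap; exists i, id; split; first by near=> q.
by near=> q.
Unshelve. all: by end_near. Qed.

Lemma holomorphicM0_comp (A1 A2 A3 : set M0) (f : A2 -> A3) (g : A1 -> A2) :
  holomorphicM0 f -> holomorphicM0 g -> holomorphicM0 (f \o g).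
Proof.
move=> hf hg a i p ap; have [j [G [hG gG]]] := hg a i p ap.
have gap := nbhs_singleton gG a ap.
have [k [F [hF fF]]] := hf _ _ _ gap; exists k, (F \o G).
split; first exact: holomorphic_at_comp.
have nF := holomorphic_at_near hG fF.
by move: gG nF; apply: filterS2 => q gq fq b bq; apply: fq; exact: gq.
Qed.

Lemma is_aut_id V : @is_aut V id.
Proof.
split; [split; first exact: holomorphicM0_id|by []|by []].
by exists id; split=> //; exact: holomorphicM0_id.
Qed.

Lemma is_aut_comp V (f g : aut V) : is_aut (f \o g).
Proof.
have [[hf [f' [hf' ff' f'f]]] ef of_] := autP f.
have [[hg [g' [hg' gg' g'g]]] eg og] := autP g.
split.
- split; first exact: holomorphicM0_comp.
  exists (g' \o f'); split; first exact: holomorphicM0_comp.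
    exact: can_comp.
  exact: can_comp.
- by move=> l a b l0 ab /=; apply: ef => //; exact: eg.
- by move=> a /=; rewrite of_.
Qed.

Lemma aut_inv_ex V (f : aut V) : exists g : aut V, cancel f g /\ cancel g f.
Proof.
have [[hf [g [hg fg gf]]] ef of_] := autP f.
suff gP : is_aut g by exists (Aut gP).
split; first by split=> //; exists f.
- move=> l a b l0 ab.
  have Aact : (pi0 @^-1` V) (act l (\val (g a))).
    by rewrite /= pi0_act // -of_ gf; exact: (set_valP a).
  pose c : (pi0 @^-1` V : set M0) := SigSub (mem_set Aact).
  have fc : f c = b by apply: val_inj; rewrite ab (ef l (g a) c) // gf.
  by rewrite -fc fg.
- by move=> a; rewrite -of_ gf.
Qed.

Definition aut_one V := Aut (@is_aut_id V).
Definition aut_mul V (f g : aut V) := Aut (is_aut_comp f g).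
Definition aut_inv V (f : aut V) : aut V := projT1 (cid (aut_inv_ex f)).

Lemma aut_mulA V : associative (@aut_mul V).
Proof. by move=> f g h; exact: aut_ext. Qed.

Lemma aut_mul1 V : left_id (aut_one V) (@aut_mul V).
Proof. by move=> f; exact: aut_ext. Qed.

Lemma aut_mulr1 V : right_id (aut_one V) (@aut_mul V).
Proof. by move=> f; exact: aut_ext. Qed.

Lemma aut_mulV V : left_inverse (aut_one V) (@aut_inv V) (@aut_mul V).
Proof.
by move=> f; apply: aut_ext => a /=; rewrite /aut_inv; case: cid => g [/= fg _].
Qed.

Lemma aut_mulrV V : right_inverse (aut_one V) (@aut_inv V) (@aut_mul V).
Proof.
by move=> f; apply: aut_ext => a /=; rewrite /aut_inv; case: cid => g [/= _ gf].
Qed.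

HB.instance Definition _ V := isGroup.Build (aut V)
  (@aut_mulA V) (@aut_mul1 V) (@aut_mulr1 V) (@aut_mulV V) (@aut_mulrV V).

Lemma aut_invK V (f : aut V) : cancel f (f^-1)%g.
Proof. exact: (fun x => congr1 (fun g : aut V => g x) (mulVg f)). Qed.

Lemma aut_invVK V (f : aut V) : cancel (f^-1)%g f.
Proof. exact: (fun x => congr1 (fun g : aut V => g x) (mulgV f)). Qed.

Lemma preimage_pi0S U V : U `<=` V -> (pi0 @^-1` U : set M0) `<=` pi0 @^-1` V.
Proof. by move=> UV m; exact: UV. Qed.

Section Restriction.
Variables (U V : opens C) (UV : U `<=` V).
Local Notation inc := (subfun (preimage_pi0S UV)).

Lemma restr_mem (f : aut V) (a : (pi0 @^-1` U : set M0)) :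
  (pi0 @^-1` U) (\val (f (inc a))).
Proof. by have [_ _ /= ->] := autP f; exact: (set_valP a). Qed.

Definition restr_fun (f : aut V) (a : (pi0 @^-1` U : set M0)) :
  (pi0 @^-1` U : set M0) := SigSub (mem_set (restr_mem f a)).

Lemma restr_holomorphic (f : aut V) : holomorphicM0 (restr_fun f).
Proof.
have [[hf _] _ _] := autP f => a i p ap.
have [j [g [hg fg]]] := hf (inc a) i p ap; exists j, g; split=> //.
by move: fg; apply: filterS => q fq b bq /=; exact: fq.
Qed.

Lemma restr_cancel (f g : aut V) : cancel f g -> cancel (restr_fun f) (restr_fun g).
Proof.
move=> fg a; apply: val_inj => /=.
by rewrite (_ : inc _ = f (inc a)) ?fg //; exact: val_inj.
Qed.

Lemma restr_is_aut (f : aut V) : is_aut (restr_fun f).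
Proof.
have [g [fg gf]] := aut_inv_ex f; have [_ ef of_] := autP f; split.
- split; first exact: restr_holomorphic.
  exists (restr_fun g); split; first exact: restr_holomorphic.
    exact: restr_cancel.
  exact: restr_cancel.
- by move=> l a b l0 ab /=; exact: ef.
- by move=> a; exact: of_.
Qed.

Definition aut_restr (f : aut V) : aut U := Aut (restr_is_aut f).

Lemma aut_restrM : {morph aut_restr : f g / (f * g)%g}.
Proof.
move=> f g; apply: aut_ext => a; apply: val_inj => /=.
by congr (\val (f _)); exact: val_inj.
Qed.

End Restriction.

Lemma aut_restr_id U (UU : U `<=` U) : aut_restr UU =1 id.
Proof.
move=> f; apply: aut_ext => a; apply: val_inj => /=.
by congr (\val (f _)); exact: val_inj.
Qed.

Lemma aut_restr_comp U V W (UV : U `<=` V) (VW : V `<=` W) (UW : U `<=` W) :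
  aut_restr UV \o aut_restr VW =1 aut_restr UW.
Proof.
move=> f; apply: aut_ext => a; apply: val_inj => /=.
by congr (\val (f _)); exact: val_inj.
Qed.

Lemma aut_compatE (I : Type) (U : I -> opens C)
    (s : forall i, aut (U i)) : compatible aut_restr s ->
  forall i j (x : (pi0 @^-1` U i : set M0)) (y : (pi0 @^-1` U j : set M0)),
    \val x = \val y -> \val (s i x) = \val (s j y).
Proof.
move=> cs i j x y xy; pose W := opens_cap (U i) (U j).
have Wi : W `<=` U i by move=> ? [].
have Wj : W `<=` U j by move=> ? [].
have Wx : (pi0 @^-1` W) (\val x).
  by split; [exact: (set_valP x)|rewrite xy; exact: (set_valP y)].
have := congr1 (fun f => \val (aut_fun f (SigSub (mem_set Wx)))) (cs i j W Wi Wj).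
rewrite /=; set a := subfun _ _; set b := subfun _ _.
have -> : a = x by exact: val_inj.
have -> : b = y by exact: val_inj.
exact: id.
Qed.

Lemma preimage_cover V (I : Type) (U : I -> opens C) :
  V `<=` \bigcup_i U i -> (pi0 @^-1` V : set M0) `<=` \bigcup_i (pi0 @^-1` U i).
Proof. by move=> cov m /cov[i _ Uim]; exists i. Qed.

Lemma pi0_chart_continuous i : continuous (pi0 \o chart i).
Proof.
rewrite (_ : pi0 \o _ = (fun p : C * C => p.1 * p.2)).
  move=> p; apply: cvgM; [exact: cvg_fst|exact: cvg_snd].
by apply/funext => -[x y]; exact: pi0_chart.
Qed.

Lemma aut_glue_fun V (I : Type) (U : I -> opens C) (UV : forall i, U i `<=` V)
    (s : forall i, aut (U i)) :
  V `<=` \bigcup_i U i -> compatible aut_restr s ->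
  exists F : (pi0 @^-1` V : set M0) -> (pi0 @^-1` V : set M0),
    [/\ forall i x, \val (F (subfun (preimage_pi0S (UV i)) x)) = \val (s i x),
        holomorphicM0 F, equivariant F & over_pi0 F].
Proof.
move=> cov cs; pose inc i := subfun (preimage_pi0S (UV i)).
have [F FE] : exists F : (pi0 @^-1` V : set M0) -> M0,
    forall i x, F (inc i x) = \val (s i x).
  exact: glue_fun (preimage_cover cov) (aut_compatE cs).
have surj (a : (pi0 @^-1` V : set M0)) : exists i x, a = inc i x.
  have [i _ Uia] := preimage_cover cov (set_valP a).
  by exists i, (SigSub (mem_set Uia)); exact: val_inj.
have FV a : (pi0 @^-1` V) (F a).
  by have [i [x ->]] := surj a; rewrite FE; exact: UV (set_valP (s i x)).
exists (fun a => SigSub (mem_set (FV a))); split.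
- by move=> i x; exact: FE.
- move=> a i p ap; have [k [x ax]] := surj a.
  have [[hs _] _ _] := autP (s k).
  have [|j [g [hg sg]]] := hs x i p; first by rewrite -ap ax.
  exists j, g; split=> //.
  have : \forall q \near p, open_set (U k) (pi0 (chart i q)).
    apply: pi0_chart_continuous; apply: open_nbhs_nbhs.
    by split; [exact: openP|rewrite /= -ap ax; exact: (set_valP x)].
  move: sg; apply: filterS2 => q sq Ukq b bq /=.
  have Ukb : (pi0 @^-1` U k) (\val b) by rewrite /= bq.
  rewrite (_ : b = inc k (SigSub (mem_set Ukb))); last exact: val_inj.
  by rewrite FE; exact: sq.
- move=> l a b l0 ab /=; have [k [x ax]] := surj a.
  have Ukb : (pi0 @^-1` U k) (\val b).
    by rewrite /= ab pi0_act // ax; exact: (set_valP x).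
  rewrite ax (_ : b = inc k (SigSub (mem_set Ukb))); last exact: val_inj.
  rewrite !FE; have [_ es _] := autP (s k); apply: es => //=.
  by rewrite ab ax.
- move=> a /=; have [k [x ->]] := surj a; rewrite FE.
  by have [_ _ /= ->] := autP (s k).
Qed.

Lemma aut_restrV U V (UV : U `<=` V) (f : aut V) :
  aut_restr UV (f^-1)%g = ((aut_restr UV f)^-1)%g.
Proof.
have fVf : (aut_restr UV f^-1 * aut_restr UV f = 1)%g.
  by rewrite -aut_restrM mulVg; apply: aut_ext => a; exact: val_inj.
by rewrite -[LHS]mulg1 -(mulgV (aut_restr UV f)) mulgA fVf mul1g.
Qed.

Lemma aut_sheaf_axiom : sheaf_axiom aut_restr.
Proof.
move=> V I U UV cov s cs; pose inc i := subfun (preimage_pi0S (UV i)).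
have cs' : compatible aut_restr (fun i => (s i)^-1)%g.
  by move=> i j W Wi Wj; rewrite !aut_restrV (cs i j W Wi Wj).
have [F [FE hF eF oF]] := aut_glue_fun UV cov cs.
have [G [GE hG _ _]] := aut_glue_fun UV cov cs'.
have surj (a : (pi0 @^-1` V : set M0)) : exists i x, a = inc i x.
  have [i _ Uia] := preimage_cover cov (set_valP a).
  by exists i, (SigSub (mem_set Uia)); exact: val_inj.
have FE' i x : F (inc i x) = inc i (s i x) by apply: val_inj; exact: FE.
have GE' i x : G (inc i x) = inc i ((s i)^-1%g x) by apply: val_inj; exact: GE.
have FP : is_aut F.
  split=> //; split=> //; exists G; split=> // a; have [i [x ->]] := surj a.
    by rewrite FE' GE' aut_invK.
  by rewrite GE' FE' aut_invVK.
exists (Aut FP); split=> [i|t tE].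
  by apply: aut_ext => x; apply: val_inj => /=; exact: FE.
apply: aut_ext => a /=; have [i [x ->]] := surj a.
by apply: val_inj; rewrite FE -(tE i).
Qed.

Definition aut_sheaf : group_sheaf C :=
  GroupSheaf aut_restrM aut_restr_id aut_restr_comp aut_sheaf_axiom.

End Surface.

(* Main.v *)
Require Import Defs.
From mathcomp Require Import all_boot all_order all_algebra all_classical all_reals all_analysis.
From mathcomp Require Import complex ring lra.

(** The key remark is that all charts cover the same points over z <> 0.  Such a
    point is determined by z and x_0 = x_i z^i, and the action multiplies x_0.
    Hence an equivariant automorphism over pi0 multiplies x_0 by a nonvanishing
    function phi(z), its multiplier ([autE]).  The isomorphism of sheaves is
    f |-> phi ([aut_multiplier]); it remains to see what happens at z = 0.

    The multiplier is meromorphic: near the point x_0 = 1 over z = 0, which lies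
    in chart 0 and is mapped into some chart j, the automorphism is holomorphic
    in these charts, and reading x_0 in chart j gives phi = h z^j with h
    holomorphic ([multiplier_local]).  The inverse automorphism has the inverse
    multiplier, so phi is a unit.

    The multiplier determines the automorphism over z <> 0, hence everywhere,
    because the surface is Hausdorff ([chart_separated]).

    Every unit is a multiplier: near 0 it is v(z) z^a with v(0) <> 0
    ([mero_unit_order]).  Multiplication of x_0 by z^a is the map sending the
    point (x, y) of chart i to the point (x, y) of chart i + a ([act_exprz]),
    which extends to the fibre over 0; multiplication by v extends too, as
    v(0) <> 0 ([twist_local]).

    The expansion v(z) z^a comes from h k = z^N, with h and k holomorphic, by
    cancelling factors z one at a time.  This needs h(z)/z to be holomorphic when
    h(0) = 0, which is Riemann's theorem on removable singularities
    ([removable_singularity]).  As holomorphic means complex differentiable near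
    the point, with no continuity of the derivative, the proof starts from
    Goursat's theorem, in a version that allows finitely many points of mere
    continuity ([goursat]).  For F continuous, and differentiable except at 0, it
    applies to z |-> (F(z) - F(w))/(z - w) and yields F(w) c(w) = A(w), where A(w)
    and c(w) are the integrals of F(z)/(z - w) and 1/(z - w) over the boundary of
    a square ([cauchy_formula]).  Both are differentiable at w = 0 and c(0) <> 0,
    so F is differentiable at 0. *)

Set Implicit Arguments.
Unset Strict Implicit.
Unset Printing Implicit Defensive.

Import Order.TTheory GRing.Theory Num.Theory numFieldNormedType.Exports.
Local Open Scope classical_set_scope.
Local Open Scope ring_scope.
Local Open Scope complex_scope.

(** * Modulus and continuity in the complex plane *)
Section ComplexModulus.
Variable R : realType.
Local Notation C := (CC R).
Implicit Types z w : C.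

(** The norm of the field of complex numbers is itself complex valued; estimates
    are carried out with its real part, so that real arithmetic applies. *)
Definition cmod z : R := complex.Re `|z|.

Lemma normCE z : `|z| = (cmod z)%:C.
Proof. by rewrite /cmod normc_def; reflexivity. Qed.

Lemma cmod_ge0 z : 0 <= cmod z.
Proof. by rewrite -ler0c -normCE normr_ge0. Qed.

Lemma cmodD z w : cmod (z + w) <= cmod z + cmod w.
Proof. by rewrite -lecR rmorphD/= -!normCE ler_normD. Qed.

Lemma cmodM z w : cmod (z * w) = cmod z * cmod w.
Proof. by apply: complexI; rewrite rmorphM/= -!normCE normrM. Qed.

Lemma cmodN z : cmod (- z) = cmod z.
Proof. by rewrite /cmod normrN. Qed.

Lemma cmodB z w : cmod (z - w) = cmod (w - z).
Proof. by rewrite /cmod distrC. Qed.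

Lemma cmodV z : cmod z^-1 = (cmod z)^-1.
Proof. by apply: complexI; rewrite fmorphV/= -!normCE normfV. Qed.

Lemma cmod0 : cmod 0 = 0.
Proof. by rewrite /cmod normr0. Qed.

Lemma cmod_eq0 z : (cmod z == 0) = (z == 0).
Proof. by rewrite -[RHS]normr_eq0 normCE -(inj_eq (@complexI R)). Qed.

Lemma cmod_gt0 z : (0 < cmod z) = (z != 0).
Proof. by rewrite lt_def cmod_ge0 andbT cmod_eq0. Qed.

Lemma cmod_real (x : R) : cmod x%:C = `|x|.
Proof. by rewrite /cmod normc_def/= expr0n addr0 sqrtr_sqr. Qed.

Lemma Re_le_cmod z : `|complex.Re z| <= cmod z.
Proof. by rewrite -lecR -normCE normc_ge_Re. Qed.

Lemma Im_le_cmod z : `|complex.Im z| <= cmod z.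
Proof.
rewrite /cmod normc_def/= -sqrtr_sqr ler_sqrt ?addr_ge0 ?sqr_ge0//.
by rewrite lerDr sqr_ge0.
Qed.

Lemma cmod_le z : cmod z <= `|complex.Re z| + `|complex.Im z|.
Proof.
rewrite /cmod normc_def/= -[leRHS]ger0_norm ?addr_ge0//.
rewrite -sqrtr_sqr ler_sqrt ?sqr_ge0// sqrrD !real_normK ?num_real//.
by rewrite -subr_ge0; have := mulr_ge0 (normr_ge0 (complex.Re z)) (normr_ge0 (complex.Im z)); lra.
Qed.

Lemma pos_complexE (e : C) : 0 < e -> e = (complex.Re e)%:C /\ 0 < complex.Re e.
Proof. by case: e => a b; rewrite ltcE/= => /andP[/eqP -> ->]. Qed.

Lemma nearCP (z : C) (P : C -> Prop) :
  (\forall w \near z, P w) <-> exists2 d : R, 0 < d & forall w, cmod (w - z) < d -> P w.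
Proof.
split=> [/nbhs_ballP[e /= /pos_complexE[-> e0] eP]|[d d0 dP]].
  exists (complex.Re e) => // w wz; apply: eP.
  by rewrite /ball/= normCE ltcR cmodB.
apply/nbhs_ballP; exists d%:C; first by rewrite /= ltcR.
by move=> w; rewrite /ball/= normCE ltcR cmodB; exact: dP.
Qed.

Lemma nearRC (x : R) (P : R -> Prop) :
  (\forall y \near x, P y) <-> exists2 d : R, 0 < d & forall y, `|y - x| < d -> P y.
Proof.
split=> [/nbhs_ballP[e /= e0 eP]|[d d0 dP]].
  by exists e => // w wz; apply: eP; rewrite /ball/= distrC.
by apply/nbhs_ballP; exists d => // w; rewrite /ball/= distrC; exact: dP.
Qed.

Lemma cvgCP (T : Type) (F : set_system T) (FF : Filter F) (f : T -> C) (l : C) :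
  (f x @[x --> F] --> l) <->
  forall e : R, 0 < e -> \forall x \near F, cmod (f x - l) < e.
Proof.
split=> [fl e e0|fl].
  by have := fl [set w | cmod (w - l) < e]; apply; apply/nearCP; exists e.
move=> A /nearCP[d d0 dA]; have := fl _ d0; rewrite /nbhs/=.
by apply: filterS => x; exact: dA.
Qed.

Lemma continuousCP (T : topologicalType) (f : T -> C) (x : T) :
  {for x, continuous f} <->
  forall e : R, 0 < e -> \forall y \near x, cmod (f y - f x) < e.
Proof. exact: cvgCP. Qed.

Lemma continuous_Re (T : topologicalType) (f : T -> C) :
  continuous f -> continuous (fun x => complex.Re (f x)).
Proof.
move=> cf x; apply/cvgrPdist_lt => e e0.
have /continuousCP/(_ _ e0) := cf x; apply: filterS => y.
apply: le_lt_trans; rewrite cmodB.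
by apply: le_trans (Re_le_cmod _); case: (f x) (f y) => ? ? [].
Qed.

Lemma continuous_Im (T : topologicalType) (f : T -> C) :
  continuous f -> continuous (fun x => complex.Im (f x)).
Proof.
move=> cf x; apply/cvgrPdist_lt => e e0.
have /continuousCP/(_ _ e0) := cf x; apply: filterS => y.
apply: le_lt_trans; rewrite cmodB.
by apply: le_trans (Im_le_cmod _); case: (f x) (f y) => ? ? [].
Qed.

Lemma continuous_Complex (T : topologicalType) (f g : T -> R) :
  continuous f -> continuous g -> continuous (fun x => (f x +i* g x : C)).
Proof.
move=> cf cg x; apply/continuousCP => e e0.
have e2 : 0 < e / 2 by rewrite divr_gt0.
have /cvgrPdist_lt/(_ _ e2) := cf x; have /cvgrPdist_lt/(_ _ e2) := cg x.
apply: filterS2 => y gy fy; apply: le_lt_trans (cmod_le _) _ => /=.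
by rewrite distrC [`|_ - g x|]distrC; lra.
Qed.

End ComplexModulus.

(** * Integrals of complex functions of a real variable *)
Section LineIntegral.
Variable R : realType.
Local Notation C := (CC R).
Local Notation mu := (@lebesgue_measure R).

Definition rint (f : R -> R) (a b : R) : R := (\int[mu]_(x in `[a, b]) f x)%R.

Lemma rint_integrable (f : R -> R) a b : continuous f ->
  mu.-integrable `[a, b] (EFin \o f).
Proof.
move=> cf; apply: continuous_compact_integrable; first exact: segment_compact.
exact: continuous_subspaceT.
Qed.

Lemma rintD (f g : R -> R) a b : continuous f -> continuous g ->
  rint (fun x => f x + g x) a b = rint f a b + rint g a b.
Proof. by move=> cf cg; rewrite /rint RintegralD//; exact: rint_integrable. Qed.

Lemma rintZ (k : R) (f : R -> R) a b : continuous f ->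
  rint (fun x => k * f x) a b = k * rint f a b.
Proof. by move=> cf; rewrite /rint RintegralZl//; exact: rint_integrable. Qed.

Lemma rint_cst (k : R) a b : a <= b -> rint (fun=> k) a b = k * (b - a).
Proof.
move=> ab; rewrite /rint Rintegral_cst//= lebesgue_measure_itv/= lte_fin.
by case: ltgtP ab => //= -> _; rewrite subrr.
Qed.

(** The half-open interval starting at m gives the same integral as the closed
    one, so the two pieces may share an endpoint. *)
Lemma rint_cat (f : R -> R) m a b : continuous f -> a <= m -> m <= b ->
  rint f a b = rint f a m + rint f m b.
Proof.
move=> cf am mb; apply/eqP; rewrite addrC -subr_eq; apply/eqP.
have fI : mu.-integrable `[m, b] (EFin \o f) by exact: rint_integrable.
rewrite /rint -(@Rintegral_itv_obnd_cbnd _ m (BRight b)); last first.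
  by apply: integrableS fI => //; apply: subset_itvr; rewrite bnd_simp.
by rewrite -(@Rintegral_itvB _ f (BLeft a)) ?bnd_simp//; exact: rint_integrable.
Qed.

Lemma le_rint (f g : R -> R) a b : continuous f -> continuous g ->
  (forall x, a <= x <= b -> f x <= g x) -> rint f a b <= rint g a b.
Proof.
by move=> cf cg fg; apply: le_Rintegral => //; exact: rint_integrable.
Qed.

Lemma rint_bound (f : R -> R) M a b : a <= b -> continuous f ->
  (forall x, a <= x <= b -> `|f x| <= M) -> `|rint f a b| <= M * (b - a).
Proof.
move=> ab cf fM; rewrite ler_norml -mulNr -!rint_cst//; apply/andP; split.
  by apply: le_rint => // [x|x /fM]; [exact: cvg_cst|rewrite ler_norml => /andP[]].
by apply: le_rint => // [x|x /fM]; [exact: cvg_cst|rewrite ler_norml => /andP[]].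
Qed.

Definition cint (f : R -> C) (a b : R) : C :=
  rint (fun x => complex.Re (f x)) a b +i* rint (fun x => complex.Im (f x)) a b.

Lemma cintD (f g : R -> C) a b : continuous f -> continuous g ->
  cint (fun x => f x + g x) a b = cint f a b + cint g a b.
Proof.
move=> cf cg; rewrite /cint; simpc.
have fRe := continuous_Re cf; have fIm := continuous_Im cf.
have gRe := continuous_Re cg; have gIm := continuous_Im cg.
rewrite -!rintD//.
congr (rint _ _ _ +i* rint _ _ _); apply/funext => x.
  by case: (f x) (g x) => ? ? [].
by case: (f x) (g x) => ? ? [].
Qed.

Lemma cintZ (k : C) (f : R -> C) a b : continuous f ->
  cint (fun x => k * f x) a b = k * cint f a b.
Proof.
move=> cf; have cRe := continuous_Re cf; have cIm := continuous_Im cf.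
have cZ (j : R) (g : R -> R) : continuous g -> continuous (fun x => j * g x).
  by move=> cg x; apply: cvgM; [exact: cvg_cst|exact: cg].
case: k => k1 k2; rewrite /cint; simpc.
rewrite -mulNr -!rintZ// -!rintD//; try exact: cZ.
congr (rint _ _ _ +i* rint _ _ _); apply/funext => x; case: (f x) => ? ? //=.
by rewrite mulNr.
Qed.

Lemma cint_cst (k : C) a b : a <= b -> cint (fun=> k) a b = k * (b - a)%:C.
Proof. by move=> ab; rewrite /cint !rint_cst//; case: k => ? ? /=; simpc. Qed.

Lemma cint_cat (f : R -> C) m a b : continuous f -> a <= m -> m <= b ->
  cint f a b = cint f a m + cint f m b.
Proof.
move=> cf am mb; rewrite /cint; simpc.
have fRe := continuous_Re cf; have fIm := continuous_Im cf.
by rewrite -!(rint_cat (m := m)).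
Qed.

Lemma cint_bound (f : R -> C) M a b : a <= b -> continuous f ->
  (forall x, a <= x <= b -> cmod (f x) <= M) -> cmod (cint f a b) <= 2 * M * (b - a).
Proof.
move=> ab cf fM; apply: le_trans (cmod_le _) _ => /=.
have fRe := continuous_Re cf; have fIm := continuous_Im cf.
rewrite -mulrA mulr_natl mulr2n lerD// rint_bound//.
  by move=> x /fM; exact/le_trans/Re_le_cmod.
by move=> x /fM; exact/le_trans/Im_le_cmod.
Qed.

End LineIntegral.

(** * Bisection of squares and contour integrals *)
Section Contours.
Variable R : realType.
Local Notation C := (CC R).
Local Notation ii := (0 +i* 1 : C).

(** The arguments a, c, s stand for the square with lower left corner a + c i
    and side s. *)
Definition quarter_additive (V : zmodType) (G : R -> R -> R -> V) :=
  forall a c s, 0 < s -> G a c s =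
    G a c (s / 2) + G (a + s / 2) c (s / 2) +
    (G a (c + s / 2) (s / 2) + G (a + s / 2) (c + s / 2) (s / 2)).

Lemma nested_intervals (a s : nat -> R) :
  (forall n, a n <= a n.+1) -> (forall n, a n.+1 + s n.+1 <= a n + s n) ->
  (forall n, 0 <= s n) -> exists p, forall n, a n <= p <= a n + s n.
Proof.
move=> aS sS s0.
have amono : nondecreasing_seq a by exact/nondecreasing_seqP.
have bmono : nonincreasing_seq (fun n => a n + s n) by exact/nonincreasing_seqP.
have ab n m : a n <= a m + s m.
  apply: (@le_trans _ _ (a (maxn n m))); first by apply: amono; exact: leq_maxl.
  apply: (@le_trans _ _ (a (maxn n m) + s (maxn n m))); first by rewrite lerDl.
  by apply: (bmono m); exact: leq_maxr.
exists (sup (range a)) => n; apply/andP; split.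
  apply: ub_le_sup; last by exists n.
  by exists (a 0%N + s 0%N) => _ [m _ <-].
by apply: ge_sup; [exists (a 0%N), 0%N|move=> _ [m _ <-]].
Qed.

Lemma small_halving (s d : R) : 0 < d -> exists n, s / 2 ^+ n < d.
Proof.
move=> d0; exists (Num.bound (s / d)).
rewrite ltr_pdivrMr ?exprn_gt0// mulrC -ltr_pdivrMr//; exact: upper_nthrootP.
Qed.

(** Goursat's bisection argument, for a functional compared with any additive
    nonnegative m instead of the area.  If G of the square is nonzero, then
    |G| > e m on it for some e > 0, hence on one of its quarters, and so on; the
    squares so chosen shrink to a point (p, q), where |G| <= e m.  Leaving m free
    is what lets [goursat] admit exceptional points. *)
Lemma square_bisection (G : R -> R -> R -> C) (m : R -> R -> R -> R) a c s :
  0 < s -> quarter_additive G -> quarter_additive m ->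
  (forall a' c' s', 0 < s' -> 0 <= m a' c' s') ->
  (forall p q, a <= p <= a + s -> c <= q <= c + s ->
    forall e, 0 < e -> exists2 d : R, 0 < d & forall a' c' s', 0 < s' -> s' < d ->
      a' <= p <= a' + s' -> c' <= q <= c' + s' -> cmod (G a' c' s') <= e * m a' c' s') ->
  G a c s = 0.
Proof.
move=> s0 Gq mq m0 small; apply/eqP; rewrite -cmod_eq0; apply/negP => /negP G0.
have {}G0 : 0 < cmod (G a c s) by rewrite lt_def G0 cmod_ge0.
have m1 : 0 < m a c s + 1 by rewrite ltr_wpDl// m0.
(* The summand 1 makes e well defined and |G| > e m strict, also when m = 0. *)
pose e := cmod (G a c s) / (m a c s + 1).
have e0 : 0 < e by rewrite divr_gt0.
pose bad (q : R * R * R) := e * m q.1.1 q.1.2 q.2 < cmod (G q.1.1 q.1.2 q.2).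
have badS : bad (a, c, s).
  rewrite /bad /= /e -mulrA gtr_pMr// mulrC ltr_pdivrMr// mul1r; lra.
pose q00 (q : R * R * R) := (q.1.1, q.1.2, q.2 / 2).
pose q10 (q : R * R * R) := (q.1.1 + q.2 / 2, q.1.2, q.2 / 2).
pose q01 (q : R * R * R) := (q.1.1, q.1.2 + q.2 / 2, q.2 / 2).
pose q11 (q : R * R * R) := (q.1.1 + q.2 / 2, q.1.2 + q.2 / 2, q.2 / 2).
pose step q := if bad (q00 q) then q00 q else if bad (q10 q) then q10 q
               else if bad (q01 q) then q01 q else q11 q.
have step_bad q : 0 < q.2 -> bad q -> bad (step q).
  move=> q0 bq; rewrite /step; case: ifP => // /negbT; rewrite /bad -leNgt => b0.
  case: ifP => // /negbT; rewrite -leNgt => b1.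
  case: ifP => // /negbT; rewrite -leNgt => b2.
  rewrite ltNge; apply/negP => b3; move: bq; rewrite /bad Gq// mq// ltNge => /negP; apply.
  apply: le_trans (cmodD _ _) _; rewrite mulrDr; apply: lerD.
    by apply: le_trans (cmodD _ _) _; rewrite mulrDr; exact: lerD.
  by apply: le_trans (cmodD _ _) _; rewrite mulrDr; exact: lerD.
have step2 q : (step q).2 = q.2 / 2.
  by rewrite /step; do 3 (case: ifP => // _).
have step11 q : 0 < q.2 -> q.1.1 <= (step q).1.1 /\
    (step q).1.1 + (step q).2 <= q.1.1 + q.2.
  by move=> q0; rewrite step2 /step; do 3 (case: ifP => /= _; first lra); lra.
have step12 q : 0 < q.2 -> q.1.2 <= (step q).1.2 /\
    (step q).1.2 + (step q).2 <= q.1.2 + q.2.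
  by move=> q0; rewrite step2 /step; do 3 (case: ifP => /= _; first lra); lra.
pose Q n := iter n step (a, c, s).
have QE n : (Q n).2 = s / 2 ^+ n.
  elim: n => [|n IH]; first by rewrite /= expr0 divr1.
  by rewrite /Q iterS step2 -/(Q n) IH exprSr invfM mulrA.
have Qs n : 0 < (Q n).2 by rewrite QE divr_gt0// exprn_gt0.
have Qbad n : bad (Q n).
  by elim: n => [//|n IH]; rewrite /Q iterS; exact: step_bad (Qs n) IH.
have [p pQ] : exists p, forall n, (Q n).1.1 <= p <= (Q n).1.1 + (Q n).2.
  apply: (@nested_intervals (fun n => (Q n).1.1) (fun n => (Q n).2)) => n /=.
  - exact: (step11 _ (Qs n)).1.
  - exact: (step11 _ (Qs n)).2.
  - exact: ltW.
have [q qQ] : exists q, forall n, (Q n).1.2 <= q <= (Q n).1.2 + (Q n).2.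
  apply: (@nested_intervals (fun n => (Q n).1.2) (fun n => (Q n).2)) => n /=.
  - exact: (step12 _ (Qs n)).1.
  - exact: (step12 _ (Qs n)).2.
  - exact: ltW.
have [d d0 Gd] := small p q (pQ 0%N) (qQ 0%N) e e0.
have [n nd] := small_halving s d0; rewrite -QE in nd.
by have := Qbad n; rewrite /bad ltNge Gd.
Qed.

(** The primitive of |x - p|^(-1/2) / 2, written with the convention that the
    square root of a negative number is 0. *)
Definition sqrt_weight (p x : R) : R := Num.sqrt (x - p) - Num.sqrt (p - x).

Lemma sqrt_weight_le p x y : x <= y -> sqrt_weight p x <= sqrt_weight p y.
Proof. by move=> xy; rewrite lerB// ler_wsqrtr//; lra. Qed.

(** With u = x + s - p and v = p - x this is sqrt (u + v) <= sqrt u + sqrt v. *)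
Lemma sqrt_weight_ge p x s : x <= p <= x + s -> Num.sqrt s <= sqrt_weight p (x + s) - sqrt_weight p x.
Proof.
move=> /andP[xp ps]; rewrite /sqrt_weight.
have u0 : 0 <= x + s - p by lra.
have v0 : 0 <= p - x by lra.
rewrite (@ler0_sqrtr _ (p - (x + s))) ?subr0; last lra.
rewrite (@ler0_sqrtr _ (x - p)) ?sub0r ?opprK; last lra.
set u := Num.sqrt (x + s - p); set v := Num.sqrt (p - x).
have uv0 : 0 <= u + v by rewrite addr_ge0 ?sqrtr_ge0.
rewrite -[leRHS]ger0_norm// -sqrtr_sqr ler_wsqrtr//.
rewrite sqrrD !sqr_sqrtr//.
have : 0 <= u * v by rewrite mulr_ge0 ?sqrtr_ge0.
by rewrite mulr2n; lra.
Qed.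

(** The mass of a square for the density |x - Re z|^(-1/2) |y - Im z|^(-1/2) / 4.
    It is finite and additive, yet at least s on a square of side s that
    contains z: this dominates the integral over the boundary, which is o(s) for a
    function continuous at z, once its value at z is subtracted. *)
Definition square_weight (z : C) (a c s : R) : R :=
  (sqrt_weight (complex.Re z) (a + s) - sqrt_weight (complex.Re z) a) *
  (sqrt_weight (complex.Im z) (c + s) - sqrt_weight (complex.Im z) c).

Lemma square_weight_quarter_additive z : quarter_additive (square_weight z).
Proof.
move=> a c s s0; rewrite /square_weight.
have E x : x + s / 2 + s / 2 = x + s :> R by lra.
by rewrite !E; ring.
Qed.

Lemma square_weight_ge0 z a c s : 0 < s -> 0 <= square_weight z a c s.
Proof. by move=> s0; rewrite mulr_ge0// subr_ge0 sqrt_weight_le//; lra. Qed.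

Lemma square_weight_ge z a c s : 0 < s -> a <= complex.Re z <= a + s ->
  c <= complex.Im z <= c + s -> s <= square_weight z a c s.
Proof.
move=> s0 az cz; apply: (@le_trans _ _ (Num.sqrt s * Num.sqrt s)).
  by rewrite -expr2 sqr_sqrtr// ltW.
by rewrite /square_weight; apply: ler_pM; rewrite ?sqrtr_ge0// sqrt_weight_ge.
Qed.

Definition hside (k : C -> C) (y a b : R) : C := cint (fun x => k (x +i* y)) a b.
Definition vside (k : C -> C) (x c d : R) : C := ii * cint (fun y => k (x +i* y)) c d.

(** The integral along the boundary, counterclockwise. *)
Definition contour (k : C -> C) (a c s : R) : C :=
  hside k c a (a + s) + vside k (a + s) c (c + s)
  - hside k (c + s) a (a + s) - vside k a c (c + s).

Definition hcont (k : C -> C) (y : R) := continuous (fun x : R => k (x +i* y)).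
Definition vcont (k : C -> C) (x : R) := continuous (fun y : R => k (x +i* y)).

Lemma hcontT (k : C -> C) y : continuous k -> hcont k y.
Proof.
move=> ck x; apply: (@continuous_comp _ _ _ (fun x : R => x +i* y : C) k); last exact: ck.
by apply: continuous_Complex => {}x; [exact: cvg_id|exact: cvg_cst].
Qed.

Lemma vcontT (k : C -> C) x : continuous k -> vcont k x.
Proof.
move=> ck y; apply: (@continuous_comp _ _ _ (fun y : R => x +i* y : C) k); last exact: ck.
by apply: continuous_Complex => {}y; [exact: cvg_cst|exact: cvg_id].
Qed.

Lemma contour_quarter_additive (k : C -> C) : continuous k -> quarter_additive (contour k).
Proof.
move=> ck a c s s0.
have E x : x + s / 2 + s / 2 = x + s by lra.
rewrite /contour !E /hside /vside.
have lo x : x <= x + s / 2 by lra.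
have hi x : x + s / 2 <= x + s by lra.
have hE y : cint (fun x => k (x +i* y)) a (a + s) =
    cint (fun x => k (x +i* y)) a (a + s / 2) +
    cint (fun x => k (x +i* y)) (a + s / 2) (a + s).
  by apply: cint_cat => //; exact: hcontT.
have vE x : cint (fun y => k (x +i* y)) c (c + s) =
    cint (fun y => k (x +i* y)) c (c + s / 2) +
    cint (fun y => k (x +i* y)) (c + s / 2) (c + s).
  by apply: cint_cat => //; exact: vcontT.
rewrite !hE !vE; ring.
Qed.

(** Continuity is asked along the four lines that carry the edges, so that the
    Cauchy kernel is covered although it has a pole inside the square. *)
Definition edge_cont k a c s :=
  [/\ hcont k c, hcont k (c + s), vcont k a & vcont k (a + s)].

Lemma edge_contT (k : C -> C) a c s : continuous k -> edge_cont k a c s.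
Proof.
move=> ck; have hk y : hcont k y by exact: hcontT.
have vk x : vcont k x by exact: vcontT.
by split; [exact: hk|exact: hk|exact: vk|exact: vk].
Qed.

Lemma edge_contD f g a c s : edge_cont f a c s -> edge_cont g a c s ->
  edge_cont (fun z => f z + g z) a c s.
Proof.
move=> [f1 f2 f3 f4] [g1 g2 g3 g4]; split=> x; apply: cvgD.
- exact: f1.
- exact: g1.
- exact: f2.
- exact: g2.
- exact: f3.
- exact: g3.
- exact: f4.
- exact: g4.
Qed.

Lemma edge_contM f g a c s : edge_cont f a c s -> edge_cont g a c s ->
  edge_cont (fun z => f z * g z) a c s.
Proof.
move=> [f1 f2 f3 f4] [g1 g2 g3 g4]; split=> x; apply: cvgM.
- exact: f1.
- exact: g1.
- exact: f2.
- exact: g2.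
- exact: f3.
- exact: g3.
- exact: f4.
- exact: g4.
Qed.

Lemma hsideD f g y a b : hcont f y -> hcont g y ->
  hside (fun z => f z + g z) y a b = hside f y a b + hside g y a b.
Proof. exact: cintD. Qed.

Lemma vsideD f g x c d : vcont f x -> vcont g x ->
  vside (fun z => f z + g z) x c d = vside f x c d + vside g x c d.
Proof. by move=> cf cg; rewrite /vside (cintD _ _ cf cg) mulrDr. Qed.

Lemma hsideZ l f y a b : hcont f y ->
  hside (fun z => l * f z) y a b = l * hside f y a b.
Proof. exact: cintZ. Qed.

Lemma vsideZ l f x c d : vcont f x ->
  vside (fun z => l * f z) x c d = l * vside f x c d.
Proof. by move=> cf; rewrite /vside (cintZ _ _ _ cf) mulrCA. Qed.

Lemma contourD f g a c s : edge_cont f a c s -> edge_cont g a c s ->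
  contour (fun z => f z + g z) a c s = contour f a c s + contour g a c s.
Proof.
move=> [f1 f2 f3 f4] [g1 g2 g3 g4]; rewrite /contour.
rewrite (hsideD _ _ f1 g1) (hsideD _ _ f2 g2) (vsideD _ _ f3 g3) (vsideD _ _ f4 g4).
ring.
Qed.

Lemma contourZ l f a c s : edge_cont f a c s ->
  contour (fun z => l * f z) a c s = l * contour f a c s.
Proof.
move=> [f1 f2 f3 f4]; rewrite /contour.
rewrite (hsideZ _ _ _ f1) (hsideZ _ _ _ f2) (vsideZ _ _ _ f3) (vsideZ _ _ _ f4).
ring.
Qed.

Definition on_edge (a c s : R) (z : C) :=
  [/\ a <= complex.Re z <= a + s, c <= complex.Im z <= c + s &
    [\/ complex.Re z = a, complex.Re z = a + s, complex.Im z = c | complex.Im z = c + s]].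

Lemma contour_bound f M a c s : 0 < s -> edge_cont f a c s ->
  (forall z, on_edge a c s z -> cmod (f z) <= M) ->
  cmod (contour f a c s) <= 8 * M * s.
Proof.
move=> s0 [f1 f2 f3 f4] fM.
have le0 x : x <= x + s by lra.
have h y : hcont f y -> y = c \/ y = c + s -> cmod (hside f y a (a + s)) <= 2 * M * s.
  move=> cf yc; apply: le_trans (cint_bound (M := M) (le0 a) cf _) _.
    move=> x xa; apply: fM; split=> //=.
      by case: yc => ->; lra.
    by case: yc => ->; [constructor 3|constructor 4].
  by rewrite addrC addKr.
have v x : vcont f x -> x = a \/ x = a + s -> cmod (vside f x c (c + s)) <= 2 * M * s.
  move=> cf xa; rewrite /vside cmodM.
  have -> : cmod ii = 1 by rewrite /cmod normc_def/= expr0n expr1n add0r sqrtr1.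
  rewrite mul1r.
  apply: le_trans (cint_bound (M := M) (le0 c) cf _) _.
    move=> y yc; apply: fM; split=> //=.
      by case: xa => ->; lra.
    by case: xa => ->; [constructor 1|constructor 2].
  by rewrite addrC addKr.
rewrite /contour.
apply: le_trans (cmodD _ _) _; rewrite cmodN.
have := v a f3 (or_introl erefl); set A := cmod _ => HA.
suff : cmod (hside f c a (a + s) + vside f (a + s) c (c + s)
    - hside f (c + s) a (a + s)) <= 6 * M * s by lra.
apply: le_trans (cmodD _ _) _; rewrite cmodN.
have := h (c + s) f2 (or_intror erefl); set B := cmod _ => HB.
suff : cmod (hside f c a (a + s) + vside f (a + s) c (c + s)) <= 4 * M * s by lra.
apply: le_trans (cmodD _ _) _.
have := h c f1 (or_introl erefl); have := v (a + s) f4 (or_intror erefl); lra.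
Qed.

Lemma contour_cst k a c s : 0 < s -> contour (fun=> k) a c s = 0.
Proof.
move=> s0; have le0 x : x <= x + s by lra.
by rewrite /contour /hside /vside !cint_cst//; ring.
Qed.

(** On each edge z is a variable part plus a constant.  The variable parts cancel
    on opposite edges, and the constants contribute - i s^2 on the horizontal edges
    and i s^2 on the vertical ones. *)
Lemma contour_id a c s : 0 < s -> contour id a c s = 0.
Proof.
move=> s0; have le0 x : x <= x + s by lra.
have cx y : continuous (fun x : R => x +i* y : C).
  by apply: continuous_Complex => x; [exact: cvg_id|exact: cvg_cst].
have cy x : continuous (fun y : R => x +i* y : C).
  by apply: continuous_Complex => y; [exact: cvg_cst|exact: cvg_id].
have hE y : hside id y a (a + s) = hside id 0 a (a + s) + y%:C * ii * s%:C.
  rewrite /hside (_ : (fun x : R => _) = (fun x : R => (x +i* 0 : C) + y%:C * ii)).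
    rewrite cintD ?cint_cst//; [by congr (_ + _ * _%:C); lra|by move=> x; exact: cvg_cst].
  by apply/funext => x; simpc.
have vE x : vside id x c (c + s) = vside id 0 c (c + s) + ii * (x%:C * s%:C).
  rewrite /vside (_ : (fun y : R => id (x +i* y)) = (fun y : R => (0 +i* y : C) + x%:C)).
    rewrite cintD ?cint_cst//; last by move=> y; exact: cvg_cst.
    by rewrite mulrDr; congr (_ + _ * (_ * _%:C)); lra.
  by apply/funext => y; simpc.
rewrite /contour (hE c) (hE (c + s)) (vE a) (vE (a + s)) !rmorphD/=; ring.
Qed.

End Contours.

(** * Goursat's theorem *)
Section GoursatTheorem.
Variable R : realType.
Local Notation C := (CC R).

(** Real epsilons in place of little-o of complex arguments. *)
Lemma differentiableCP (k : C -> C) (z : C) : differentiable k z <->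
  exists l : C, forall e : R, 0 < e -> \forall w \near z,
    cmod (k w - k z - l * (w - z)) <= e * cmod (w - z).
Proof.
split=> [/derivable1_diffP|[l kl]].
  rewrite /derivable; set q := (X in cvg (X @ _)) => /cvg_ex[l ql]; exists l => e e0.
  have /nearCP[d d0 dq] : \forall h \near (0 : C), h != 0 -> cmod (q h - l) < e.
    by have /cvgCP/(_ e e0) := ql.
  apply/nearCP; exists d => // w wz; have [->|wz0] := eqVneq w z.
    by rewrite !subrr mulr0 subr0 cmod0 mulr0.
  have wz1 : w - z != 0 by rewrite subr_eq0.
  have := dq (w - z); rewrite subr0 => /(_ wz wz1); rewrite /q /= => /ltW.
  rewrite [_ *: 1]mulr1 subrK => qe.
  rewrite -ler_pdivrMr ?cmod_gt0// -cmodV -cmodM mulrC.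
  by rewrite mulrBr [l * _]mulrC mulKf.
apply/derivable1_diffP; apply/cvg_ex; exists l; apply/cvgCP => e e0.
have e2 : 0 < e / 2 by rewrite divr_gt0.
have /nearCP[d d0 dk] := kl _ e2.
suff : \forall h \near (0 : C), h != 0 ->
    cmod (h^-1 *: ((k \o shift z) (h *: 1) - k z) - l) < e by [].
apply/nearCP; exists d => // h; rewrite subr0 => hd h0.
have := dk (h + z); rewrite addrK => /(_ hd) khl.
rewrite /= [_ *: 1]mulr1.
have -> : h^-1 *: (k (h + z) - k z) - l = h^-1 * (k (h + z) - k z - l * h).
  by rewrite mulrBr [l * _]mulrC mulKf.
rewrite cmodM cmodV mulrC ltr_pdivrMr ?cmod_gt0//.
apply: le_lt_trans khl _; rewrite ltr_pM2r ?cmod_gt0//; lra.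
Qed.

(** Affine functions have zero contour integral, so only the error of the
    first-order approximation contributes. *)
Lemma contour_affine_bound (k : C -> C) (l z : C) (e : R) a c s : 0 < s ->
  continuous k -> a <= complex.Re z <= a + s -> c <= complex.Im z <= c + s ->
  (forall w, on_edge a c s w -> cmod (k w - k z - l * (w - z)) <= e) ->
  cmod (contour k a c s) <= 8 * e * s.
Proof.
move=> s0 ck az cz ke.
have cid_ : edge_cont (@id C) a c s by apply: edge_contT => x; exact: cvg_id.
have ccst (m : C) : edge_cont (fun=> m) a c s.
  by apply: edge_contT; exact: cst_continuous.
have ek := edge_contT a c s ck.
have kE : k = (fun w => (k w - k z - l * (w - z)) + (l * w + (k z - l * z))).
  by apply/funext => w; ring.
have c1 : edge_cont (fun w => k w - k z - l * (w - z)) a c s.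
  rewrite (_ : (fun w => _) = (fun w => k w + (- l * w + (l * z - k z)))).
    exact: (edge_contD ek (edge_contD (edge_contM (ccst (- l)) cid_) (ccst _))).
  by apply/funext => w; ring.
have c2 : edge_cont (fun w => l * w) a c s := edge_contM (ccst l) cid_.
have c3 := ccst (k z - l * z).
rewrite kE (contourD c1 (edge_contD c2 c3)) (contourD c2 c3) (contourZ _ cid_).
rewrite (contour_id _ _ s0) (contour_cst _ _ _ s0) mulr0 !addr0.
exact: contour_bound s0 c1 ke.
Qed.

Lemma near_in_square (z : C) a c s (w : C) :
  a <= complex.Re z <= a + s -> c <= complex.Im z <= c + s -> on_edge a c s w ->
  cmod (w - z) <= 2 * s.
Proof.
move=> az cz [aw cw _]; apply: le_trans (cmod_le _) _.
have -> : complex.Re (w - z) = complex.Re w - complex.Re z by case: w z {az cz aw cw} => ? ? [].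
have -> : complex.Im (w - z) = complex.Im w - complex.Im z by case: w z {az cz aw cw} => ? ? [].
have -> : 2 * s = s + s by rewrite mulr_natl.
by apply: lerD; rewrite ler_norml; apply/andP; split; lra.
Qed.

(** P is a finite set of points at which k is only supposed continuous.  At a
    point of differentiability the contour integral over a small square is
    o(s^2), small against the area; at a point of P it is o(s), small against
    [square_weight].  [square_bisection] applies to the sum m of the area and the weights. *)
Lemma goursat (k : C -> C) (P : seq C) (a c s : R) : 0 < s -> continuous k ->
  (forall z : C, a <= complex.Re z <= a + s -> c <= complex.Im z <= c + s ->
    z \notin P -> differentiable k z) ->
  contour k a c s = 0.
Proof.
move=> s0 ck dk.
pose m a c s : R := s ^+ 2 + \sum_(z <- P) square_weight z a c s.
apply: (@square_bisection _ (contour k) m) => //.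
- exact: contour_quarter_additive.
- move=> a' c' s' s'0; rewrite /m.
  under eq_bigr do rewrite square_weight_quarter_additive//.
  by rewrite !big_split/=; set u := \sum_(z <- P) _; field.
- move=> a' c' s' s'0; rewrite addr_ge0 ?sqr_ge0// sumr_ge0// => z _.
  exact: square_weight_ge0.
move=> p q ap cq e e0; pose z : C := p +i* q.
have [zP|zP] := boolP (z \in P).
  have e8 : 0 < e / 8 by rewrite divr_gt0.
  have /nearCP[d d0 dz] := (continuousCP k z).1 (ck z) _ e8.
  exists (d / 2) => [|a' c' s' s'0 s'd ap' cq']; first by rewrite divr_gt0.
  have kb w : on_edge a' c' s' w -> cmod (k w - k z - 0 * (w - z)) <= e / 8.
    move=> ew; rewrite mul0r subr0; apply/ltW/dz.
    apply: le_lt_trans (near_in_square (z := z) ap' cq' ew) _; lra.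
  apply: le_trans (contour_affine_bound (z := z) s'0 ck ap' cq' kb) _.
  have -> : 8 * (e / 8) = e by lra.
  rewrite ler_pM2l// /m (big_rem z)//=.
  apply: le_trans (square_weight_ge (z := z) s'0 ap' cq') _.
  rewrite addrCA lerDl addr_ge0 ?sqr_ge0// sumr_ge0// => x _.
  exact: square_weight_ge0.
have [l kl] := (differentiableCP k z).1 (dk z ap cq zP).
(* 16 is the constant 8 of [contour_affine_bound] times the 2 of |w - z| <= 2 s. *)
have e16 : 0 < e / 16 by rewrite divr_gt0.
have /nearCP[d d0 dz] := kl _ e16.
exists (d / 2) => [|a' c' s' s'0 s'd ap' cq']; first by rewrite divr_gt0.
have kb w : on_edge a' c' s' w -> cmod (k w - k z - l * (w - z)) <= e / 16 * (2 * s').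
  move=> ew; have ws := near_in_square (z := z) ap' cq' ew.
  apply: le_trans (dz _ _) _; first by apply: le_lt_trans ws _; lra.
  by rewrite ler_pM2l.
apply: le_trans (contour_affine_bound (z := z) s'0 ck ap' cq' kb) _.
have -> : 8 * (e / 16 * (2 * s')) * s' = e * s' ^+ 2 by field.
rewrite ler_pM2l// /m lerDl sumr_ge0// => x _; exact: square_weight_ge0.
Qed.

End GoursatTheorem.

(** * The Cauchy kernel on a square *)
Section ContourEstimates.
Variable R : realType.
Local Notation C := (CC R).

Lemma eq_cint (f g : R -> C) a b : (forall x, a <= x <= b -> f x = g x) ->
  cint f a b = cint g a b.
Proof.
move=> fg; rewrite /cint /rint; congr (_ +i* _); apply: eq_Rintegral => x;
  by rewrite inE/= in_itv/= => /fg ->.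
Qed.

Lemma eq_contour (f g : C -> C) a c s : 0 < s ->
  (forall z, on_edge a c s z -> f z = g z) -> contour f a c s = contour g a c s.
Proof.
move=> s0 fg; have h y : y = c \/ y = c + s -> hside f y a (a + s) = hside g y a (a + s).
  move=> yc; apply: eq_cint => x xa; apply: fg; split=> //=.
    by case: yc => ->; lra.
  by case: yc => ->; [constructor 3|constructor 4].
have v x : x = a \/ x = a + s -> vside f x c (c + s) = vside g x c (c + s).
  move=> xa; congr (_ * _); apply: eq_cint => y yc; apply: fg; split=> //=.
    by case: xa => ->; lra.
  by case: xa => ->; [constructor 1|constructor 2].
rewrite /contour (h c (or_introl erefl)) (h (c + s) (or_intror erefl)).
by rewrite (v a (or_introl erefl)) (v (a + s) (or_intror erefl)).
Qed.

Lemma edge_contV (a c s : R) (w : C) :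
  a < complex.Re w < a + s -> c < complex.Im w < c + s ->
  edge_cont (fun z : C => (z - w)^-1) a c s.
Proof.
case: w => w1 w2 /= aw cw.
have cRe (y : R) : continuous (fun x : R => (x +i* y) - (w1 +i* w2) : C).
  rewrite (_ : (fun x : R => _) = (fun x => (x - w1) +i* (y - w2))).
    apply: continuous_Complex; last exact: cst_continuous.
    by move=> x; apply: cvgB; [exact: cvg_id|exact: cvg_cst].
  by apply/funext => x.
have cIm (x : R) : continuous (fun y : R => (x +i* y) - (w1 +i* w2) : C).
  rewrite (_ : (fun y : R => _) = (fun y => (x - w1) +i* (y - w2))).
    apply: continuous_Complex; first exact: cst_continuous.
    by move=> y; apply: cvgB; [exact: cvg_id|exact: cvg_cst].
  by apply/funext => y.
have neq (x y : R) : x != w1 \/ y != w2 -> (x +i* y) - (w1 +i* w2) != 0 :> C.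
  by rewrite subr_eq0 eq_complex/= negb_and => -[->|->]; rewrite ?orbT.
have ne a' w' : a' < w' -> a' != w' by move=> /lt_eqF ->.
have ne' a' w' : w' < a' -> a' != w' by move=> /gt_eqF ->.
move: aw cw => /andP[aw1 aw2] /andP[cw1 cw2].
split=> x; apply: cvgV.
- by apply: neq; right; exact: ne.
- exact: cRe.
- by apply: neq; right; exact: ne'.
- exact: cRe.
- by apply: neq; left; exact: ne.
- exact: cIm.
- by apply: neq; left; exact: ne'.
- exact: cIm.
Qed.

Lemma Re_inv (x y : R) : complex.Re ((x +i* y : C)^-1) = x / (x ^+ 2 + y ^+ 2).
Proof. by []. Qed.

Lemma Im_inv (x y : R) : complex.Im ((x +i* y : C)^-1) = - (y / (x ^+ 2 + y ^+ 2)).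
Proof. by []. Qed.

(** Each of the four edges contributes at least 1 to the imaginary part, since
    s / (x^2 + s^2) >= 1 / (2 s) for |x| <= s. *)
Lemma contour_inv_neq0 (s : R) : 0 < s ->
  contour (fun z : C => (z - 0)^-1) (- s) (- s) (s + s) != 0.
Proof.
move=> s0.
have [h1 h2 v1 v2] : edge_cont (fun z : C => (z - 0)^-1) (- s) (- s) (s + s).
  by apply: edge_contV => /=; lra.
have E : - s + (s + s) = s by lra.
rewrite E in h2 v2.
have low x : - s <= x <= s -> 1 / (2 * s) <= s / (x ^+ 2 + s ^+ 2).
  move=> xs; have d0 : 0 < x ^+ 2 + s ^+ 2 by rewrite ltr_wpDl ?sqr_ge0// exprn_gt0.
  rewrite ler_pdivlMr// mulrC mulrA ler_pdivrMr ?mulr_gt0//.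
  have : x ^+ 2 <= s ^+ 2 by rewrite -subr_ge0 subr_sqr mulr_ge0//; lra.
  by rewrite mulr1; nra.
have int1 (f : R -> R) : continuous f ->
    (forall x, - s <= x <= s -> f x = s / (x ^+ 2 + s ^+ 2)) -> 1 <= rint f (- s) s.
  move=> cf fE; have -> : 1 = rint (fun=> 1 / (2 * s)) (- s) s.
    by rewrite rint_cst; [field; lra|lra].
  by apply: le_rint => // [|x xs]; [exact: cst_continuous|rewrite fE ?low].
have int2 (f : R -> R) : continuous f ->
    (forall x, - s <= x <= s -> f x = - (s / (x ^+ 2 + s ^+ 2))) -> rint f (- s) s <= - 1.
  move=> cf fE; have -> : - 1 = rint (fun=> - (1 / (2 * s))) (- s) s.
    by rewrite rint_cst; [field; lra|lra].
  by apply: le_rint => // [|x xs]; [exact: cst_continuous|rewrite fE ?lerN2 ?low].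
set I := contour _ _ _ _.
suff : 4 <= complex.Im I by apply: contraTneq => ->; rewrite /= -ltNge; lra.
rewrite /I /contour E /hside /vside /cint.
have Im_sum (p q r t p' q' r' t' : R) :
  complex.Im ((p +i* p') + (0 +i* 1) * (q +i* q') - (r +i* r') - (0 +i* 1) * (t +i* t') : C)
  = p' + q - r' - t by rewrite /=; lra.
rewrite Im_sum.
have := int1 _ (continuous_Im h1); have := int1 _ (continuous_Re v2).
have := int2 _ (continuous_Im h2); have := int2 _ (continuous_Re v1).
set r1 := rint _ _ _; set r2 := rint _ _ _; set r3 := rint _ _ _; set r4 := rint _ _ _.
move=> H1 H2 H3 H4.
have {}H1 : r1 <= - 1.
  by apply: H1 => x xs; rewrite subr0 Re_inv sqrrN mulNr addrC.
have {}H2 : r2 <= - 1.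
  by apply: H2 => x xs; rewrite subr0 Im_inv.
have {}H3 : 1 <= r3.
  by apply: H3 => x xs; rewrite subr0 Re_inv addrC.
have {}H4 : 1 <= r4.
  by apply: H4 => x xs; rewrite subr0 Im_inv sqrrN mulNr opprK.
lra.
Qed.

Lemma continuous_square_bounded (F : C -> C) (a c s : R) : continuous F -> 0 < s ->
  exists M, forall z, on_edge a c s z -> cmod (F z) <= M.
Proof.
move=> cF s0; pose L (p : R * R) : C := p.1 +i* p.2.
have cL : continuous L.
  by apply: continuous_Complex => p; [exact: cvg_fst|exact: cvg_snd].
have cmodc : continuous (fun p : R * R => cmod (F (L p))).
  move=> p; apply/cvgrPdist_lt => e e0.
  have := cF (L p); have := cL p => cLp cFp.
  have /continuousCP/(_ e e0) := continuous_comp cLp cFp.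
  apply: filterS => q; apply: le_lt_trans => /=; rewrite ler_norml; apply/andP; split.
    rewrite lerNl opprB lerBlDr; apply: le_trans (cmodD _ _); by rewrite subrK.
  rewrite lerBlDr cmodB; apply: le_trans (cmodD _ _); by rewrite subrK.
have cpt : compact (`[a, a + s]%classic `*` `[c, c + s]%classic).
  by apply: compact_setX; exact: segment_compact.
have [|p _ pM] := compact_EVT_max _ cpt (continuous_subspaceT cmodc).
  by exists (a, c); split=> /=; rewrite in_itv/=; lra.
exists (cmod (F (L p))) => -[x y] [/= xa yc _].
by apply: (pM (x, y)); rewrite inE; split; rewrite /= in_itv.
Qed.

End ContourEstimates.

(** * Cauchy's formula and removable singularities *)
Section Removable.
Variable R : realType.
Local Notation C := (CC R).

Lemma near_differentiable (f g : C -> C) (z : C) :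
  (\forall w \near z, f w = g w) -> differentiable f z -> differentiable g z.
Proof.
move=> fg /differentiableCP[l fl]; apply/differentiableCP; exists l => e e0.
rewrite -(nbhs_singleton fg).
by move: fg (fl e e0); apply: filterS2 => w ->.
Qed.

(** The square has centre 0 and half-side s, hence the side s + s. *)
Definition cauchy_transform (F : C -> C) (s : R) (w : C) : C :=
  contour (fun z : C => F z * (z - w)^-1) (- s) (- s) (s + s).

Lemma on_edge_cmod (s : R) (z : C) : 0 < s ->
  on_edge (- s) (- s) (s + s) z -> s <= cmod z.
Proof.
move=> s0 [_ _]; have -> : - s + (s + s) = s by lra.
case=> zs; [have := Re_le_cmod z|have := Re_le_cmod z|have := Im_le_cmod z|
  have := Im_le_cmod z]; rewrite zs ?normrN gtr0_norm//.
Qed.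

Lemma small_in_square (s : R) (w : C) : cmod w < s ->
  - s < complex.Re w < - s + (s + s) /\ - s < complex.Im w < - s + (s + s).
Proof.
have -> : - s + (s + s) = s by lra.
move=> ws; rewrite -!ltr_norml; split.
  exact: le_lt_trans (Re_le_cmod _) ws.
exact: le_lt_trans (Im_le_cmod _) ws.
Qed.

(** From 1/(z - w) = 1/z + w/z^2 + w^2/(z^2 (z - w)): the last term contributes
    O(w^2), as the kernel is bounded on the boundary for |w| < s/2. *)
Lemma cauchy_transform_differentiable (F : C -> C) (s : R) : 0 < s ->
  continuous F -> differentiable (cauchy_transform F s) 0.
Proof.
move=> s0 cF; have ss0 : 0 < s + s by lra.
have [M FM] := continuous_square_bounded (- s) (- s) cF ss0.
have inv_cont w : cmod w < s ->
    edge_cont (fun z : C => (z - w)^-1) (- s) (- s) (s + s).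
  by move=> /small_in_square[]; exact: edge_contV.
have eF := edge_contT (- s) (- s) (s + s) cF.
have w0 : cmod (0 : C) < s by rewrite cmod0.
have e0_ := inv_cont 0 w0.
pose K := M / (s ^+ 2 * (s / 2)).
pose F2 z := F z * ((z - 0)^-1 * (z - 0)^-1).
have eF2 : edge_cont F2 (- s) (- s) (s + s) := edge_contM eF (edge_contM e0_ e0_).
apply/differentiableCP; exists (contour F2 (- s) (- s) (s + s)) => e e0.
pose K' := 8 * `|K| * (s + s).
have K'0 : 0 <= K' by rewrite !mulr_ge0//; lra.
apply/nearCP; exists (Num.min (s / 2) (e / (K' + 1))).
  by rewrite lt_min !divr_gt0// ltr_wpDl.
move=> w; rewrite !subr0 lt_min => /andP[ws we].
have ws' : cmod w < s by lra.
have ew := inv_cont w ws'.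
pose G z := w * w * (F2 z * (z - w)^-1).
have eFw : edge_cont (fun z => F z * (z - w)^-1) (- s) (- s) (s + s) := edge_contM eF ew.
have eF0 : edge_cont (fun z => F z * (z - 0)^-1) (- s) (- s) (s + s) := edge_contM eF e0_.
have eG0 : edge_cont (fun z => F2 z * (z - w)^-1) (- s) (- s) (s + s) := edge_contM eF2 ew.
have ccst (m : C) : edge_cont (fun=> m) (- s) (- s) (s + s).
  by apply: edge_contT; exact: cst_continuous.
have eG : edge_cont G (- s) (- s) (s + s) := edge_contM (ccst (w * w)) eG0.
have lb z : on_edge (- s) (- s) (s + s) z -> s / 2 <= cmod (z - w).
  move=> /(on_edge_cmod s0) sz; have := cmodD (z - w) w; rewrite subrK; lra.
have FE : cauchy_transform F s w =
    cauchy_transform F s 0 + (w * contour F2 (- s) (- s) (s + s) +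
      contour G (- s) (- s) (s + s)).
  rewrite /cauchy_transform -(contourZ w eF2).
  have eF2w : edge_cont (fun z => w * F2 z) (- s) (- s) (s + s) := edge_contM (ccst w) eF2.
  rewrite -(contourD eF2w eG) -(contourD eF0 (edge_contD eF2w eG)).
  apply: eq_contour => // z zs; rewrite /G /F2 subr0.
  have z0 : z != 0 by rewrite -cmod_gt0; apply: lt_le_trans (on_edge_cmod s0 zs).
  have zw : z - w != 0 by rewrite -cmod_gt0; apply: lt_le_trans (lb z zs); lra.
  by field; rewrite z0 zw.
rewrite FE [contour F2 _ _ _ * w]mulrC.
set X := contour G _ _ _; set Y := cauchy_transform F s 0; set Z := w * _.
have -> : Y + (Z + X) - Y - Z = X by ring.
rewrite /X (contourZ (w * w) eG0) cmodM cmodM.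
have bd : cmod (contour (fun z => F2 z * (z - w)^-1) (- s) (- s) (s + s)) <= K'.
  apply: (contour_bound (M := `|K|) ss0 eG0) => z zs.
  have sz := on_edge_cmod s0 zs; have wz := lb z zs.
  have M0 : 0 <= M by exact: le_trans (cmod_ge0 _) (FM z zs).
  apply: le_trans (ler_norm K); rewrite /K /F2 !cmodM !cmodV subr0.
  have i1 : (cmod z)^-1 <= s^-1 by rewrite lef_pV2// posrE//; lra.
  have i2 : (cmod (z - w))^-1 <= (s / 2)^-1 by rewrite lef_pV2// posrE//; lra.
  have z0 := cmod_ge0 z; have zw0 := cmod_ge0 (z - w).
  have -> : M / (s ^+ 2 * (s / 2)) = M * (s^-1 * s^-1) * (s / 2)^-1.
    by field; rewrite lt0r_neq0.
  apply: ler_pM i2; rewrite ?mulr_ge0 ?invr_ge0 ?cmod_ge0//.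
  by apply: ler_pM; rewrite ?mulr_ge0 ?invr_ge0 ?cmod_ge0 ?FM//; apply: ler_pM; rewrite ?invr_ge0.
rewrite -mulrA mulrC; apply: ler_wpM2r; first exact: cmod_ge0.
apply: (@le_trans _ _ (cmod w * K')); first by rewrite ler_wpM2l ?cmod_ge0.
have K1 : 0 < K' + 1 by lra.
move: we; rewrite ltr_pdivlMr// => we.
by have := cmod_ge0 w; lra.
Qed.

(** Goursat's theorem for the difference quotient G of F at w, extended by the
    derivative at z = w; the exceptional points are 0 and w. *)
Lemma cauchy_formula (F : C -> C) (s : R) (w : C) : continuous F ->
  (forall z : C, - s <= complex.Re z <= s -> - s <= complex.Im z <= s -> z != 0 ->
    differentiable F z) ->
  w != 0 -> cmod w < s ->
  cauchy_transform F s w = F w * cauchy_transform (fun=> 1) s w.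
Proof.
move=> cF dF w0 ws; have s0 : 0 < s by exact: le_lt_trans (cmod_ge0 w) ws.
have ss0 : 0 < s + s by lra.
have E : - s + (s + s) = s by lra.
have [wRe wIm] := small_in_square ws; rewrite !E in wRe wIm.
have [l Fl] : exists l : C, forall e : R, 0 < e -> \forall z \near w,
    cmod (F z - F w - l * (z - w)) <= e * cmod (z - w).
  by apply/differentiableCP/dF => //; lra.
pose q z := (F z - F w) * (z - w)^-1.
pose G z := if z == w then l else q z.
have dB z : differentiable (fun y : C => y - w) z.
  by apply: differentiableB; [exact: ex_diff|exact: differentiable_cst].
have near_neq (z : C) : z != w -> \forall y \near z, q y = G y.
  move=> zw; apply/nearCP; exists (cmod (z - w)); first by rewrite cmod_gt0 subr_eq0.
  move=> y yz; rewrite /G; case: eqP => // yw; move: yz.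
  by rewrite yw cmodB ltxx.
have cG : continuous G.
  move=> z; have [->|zw] := eqVneq z w.
    apply/continuousCP => e e0; have e2 : 0 < e / 2 by lra.
    have /nearCP[d d0 Fd] := Fl _ e2; apply/nearCP; exists d => // y yw.
    rewrite /G eqxx; case: eqVneq => [_|yw']; first by rewrite subrr cmod0.
    have yw1 : y - w != 0 by rewrite subr_eq0.
    have -> : q y - l = (F y - F w - l * (y - w)) * (y - w)^-1.
      by rewrite /q; field.
    rewrite cmodM cmodV ltr_pdivrMr ?cmod_gt0//.
    apply: le_lt_trans (Fd y yw) _; rewrite ltr_pM2r ?cmod_gt0//; lra.
  have zw1 : z - w != 0 by rewrite subr_eq0.
  have cq : {for z, continuous q}.
    have c1 : (F y - F w) @[y --> z] --> F z - F w.
      exact: cvgB (cF z) (cvg_cst _).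
    have c2 : (y - w) @[y --> z] --> z - w := differentiable_continuous (dB z).
    exact: cvgM c1 (cvgV zw1 c2).
  apply/continuousCP => e e0.
  have /continuousCP/(_ e e0) := cq; have nn := near_neq z zw.
  rewrite -(nbhs_singleton nn).
  by move: nn; apply: filterS2 => y ->.
have dG (z : C) : - s <= complex.Re z <= - s + (s + s) -> - s <= complex.Im z <= - s + (s + s) ->
    z \notin [:: 0; w] -> differentiable G z.
  rewrite E !inE negb_or => zRe zIm /andP[z0 zw].
  apply: near_differentiable (near_neq z zw) _.
  have zw1 : z - w != 0 by rewrite subr_eq0.
  have d1 : differentiable (fun y : C => F y - F w) z.
    by apply: differentiableB; [exact: dF|exact: differentiable_cst].
  exact: differentiableM d1 (differentiableV (dB z) zw1).
have G0 := goursat ss0 cG dG.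
have ew : edge_cont (fun z : C => (z - w)^-1) (- s) (- s) (s + s).
  by apply: edge_contV; rewrite E.
have eF := edge_contT (- s) (- s) (s + s) cF.
have ccst (m : C) : edge_cont (fun=> m) (- s) (- s) (s + s).
  by apply: edge_contT; exact: cst_continuous.
have e1 : edge_cont (fun z => F z * (z - w)^-1) (- s) (- s) (s + s) := edge_contM eF ew.
have e2 : edge_cont (fun z => 1 * (z - w)^-1) (- s) (- s) (s + s) := edge_contM (ccst 1) ew.
have e3 : edge_cont (fun z => - F w * (1 * (z - w)^-1)) (- s) (- s) (s + s) :=
  edge_contM (ccst _) e2.
have : contour G (- s) (- s) (s + s) = cauchy_transform F s w +
    - F w * cauchy_transform (fun=> 1) s w.
  rewrite /cauchy_transform -(contourZ _ e2) -(contourD e1 e3).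
  apply: eq_contour => // z [zRe zIm zs]; rewrite /G; case: eqP => [zw|_].
    move: zs; rewrite zw E; by case=> h; exfalso; rewrite h in wRe wIm; lra.
  by rewrite /q; ring.
by rewrite G0 mulNr => /esym/eqP; rewrite subr_eq0 => /eqP.
Qed.

(** Near 0 the function F is the quotient of two Cauchy integrals differentiable
    at 0: [cauchy_formula] gives this for w <> 0, and continuity for w = 0. *)
Lemma removable_on_square (F : C -> C) (s : R) : 0 < s -> continuous F ->
  (forall z : C, - s <= complex.Re z <= s -> - s <= complex.Im z <= s -> z != 0 ->
    differentiable F z) ->
  differentiable F 0.
Proof.
move=> s0 cF dF.
pose A := cauchy_transform F s; pose c := cauchy_transform (fun=> 1) s.
have dA : differentiable A 0 := cauchy_transform_differentiable s0 cF.
have dc : differentiable c 0.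
  exact: cauchy_transform_differentiable s0 (@cst_continuous _ _ (1 : C)).
have c0 : c 0 != 0.
  rewrite /c /cauchy_transform (_ : (fun z : C => _) = (fun z : C => (z - 0)^-1)).
    exact: contour_inv_neq0.
  by apply/funext => z; rewrite mul1r.
have dq : differentiable (A * (fun w => (c w)^-1)) 0.
  exact: differentiableM dA (differentiableV dc c0).
have Fq w : w != 0 -> cmod w < s -> c w != 0 -> A w * (c w)^-1 = F w.
  by move=> w0 ws cw; rewrite /A cauchy_formula// mulfK.
have cnz : \forall w \near (0 : C), c w != 0.
  have cc : {for 0, continuous c} := differentiable_continuous dc.
  have cc0 : 0 < cmod (c 0) by rewrite cmod_gt0.
  have /continuousCP/(_ _ cc0) := cc; apply: filterS => w.
  by apply: contraTneq => ->; rewrite sub0r cmodN ltxx.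
have nFq : \forall w \near (0 : C), w != 0 -> A w * (c w)^-1 = F w.
  have : \forall w \near (0 : C), cmod w < s.
    by apply/nearCP; exists s => // w; rewrite subr0.
  by move: cnz; apply: filterS2 => w cw ws w0; exact: Fq.
have F0 : A 0 * (c 0)^-1 = F 0.
  have cq := differentiable_continuous dq.
  have l1 : (A * (fun w => (c w)^-1)) x @[x --> 0^'] --> A 0 * (c 0)^-1.
    exact: cvg_trans (cvg_app _ (@nbhs_dnbhs _ _)) cq.
  have l2 : F x @[x --> 0^'] --> F 0.
    exact: cvg_trans (cvg_app _ (@nbhs_dnbhs _ _)) (cF 0).
  have l3 : F x @[x --> 0^'] --> A 0 * (c 0)^-1.
    apply: cvg_trans l1; apply: near_eq_cvg; exact: nFq.
  exact: (cvg_unique (@norm_hausdorff _ _) l3 l2).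
apply: near_differentiable dq; move: nFq; apply: filterS => w wF.
by have [->|/wF] := eqVneq w 0.
Qed.

Lemma clamp_lipschitz (t x y : R) :
  `|Num.max (- t) (Num.min t y) - Num.max (- t) (Num.min t x)| <= `|y - x|.
Proof.
have h2 := ler_norm (y - x); have h1 := ler_norm (x - y); rewrite distrC in h1.
rewrite ler_norml; apply/andP.
case: (leP t x) => ?; case: (leP t y) => ?; case: (leP (- t) t) => ?;
  case: (leP (- t) x) => ?; case: (leP (- t) y) => ?; split; lra.
Qed.

(** Composition with this retraction onto a square turns a function defined near
    0 into one continuous on the whole plane, as [removable_on_square] wants. *)
Definition clamp (t : R) (z : C) : C :=
  Num.max (- t) (Num.min t (complex.Re z)) +i* Num.max (- t) (Num.min t (complex.Im z)).

Lemma removable_singularity (F : C -> C) : {for 0, continuous F} ->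
  (\forall z \near (0 : C), z != 0 -> differentiable F z) -> differentiable F 0.
Proof.
move=> cF /nearCP[d d0 dF].
(* The square of half-side t lies in the disc of radius d, and the retraction onto it
   is the identity near each point of the smaller square of half-side s. *)
pose t := d / 4; pose s := t / 2.
have t0 : 0 < t by rewrite divr_gt0.
have s0 : 0 < s by rewrite divr_gt0.
have clampB (x : R) : `|Num.max (- t) (Num.min t x)| <= t.
  rewrite ler_norml; apply/andP; split; first by rewrite le_max lexx.
  by rewrite ge_max ge_min lexx /=; lra.
have clamp_cmod z : cmod (clamp t z) < d.
  apply: le_lt_trans (cmod_le _) _ => /=.
  by have := clampB (complex.Re z); have := clampB (complex.Im z); rewrite /t; lra.
have cclampR : continuous (fun x : R => Num.max (- t) (Num.min t x)).
  move=> x; apply/cvgrPdist_lt => e e0; apply/nearRC; exists e => // y.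
  by apply: le_lt_trans; rewrite distrC clamp_lipschitz.
have cclamp : continuous (clamp t).
  have cRe := @continuous_Re R _ id (fun x => cvg_id).
  have cIm := @continuous_Im R _ id (fun x => cvg_id).
  apply: continuous_Complex => z.
    exact: (@continuous_comp _ _ _ _ _ _ (cRe z) (cclampR _)).
  exact: (@continuous_comp _ _ _ _ _ _ (cIm z) (cclampR _)).
have clamp_id (z : C) : `|complex.Re z| <= t -> `|complex.Im z| <= t -> clamp t z = z.
  have E (x : R) : `|x| <= t -> Num.max (- t) (Num.min t x) = x.
    rewrite ler_norml => /andP[x1 x2]; rewrite (min_idPr x2); exact/max_idPr.
  by case: z => x y /= xt yt; rewrite /clamp /= !E.
have cFc : continuous (F \o clamp t).
  move=> z; apply: continuous_comp; first exact: cclamp.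
  have [->//|z0] := eqVneq (clamp t z) 0.
  by apply: differentiable_continuous; apply: dF; rewrite ?subr0.
have near_id (z : C) : `|complex.Re z| <= s -> `|complex.Im z| <= s ->
    \forall w \near z, F w = (F \o clamp t) w.
  move=> zRe zIm; apply/nearCP; exists s => // w wz /=; rewrite clamp_id//.
    have := Re_le_cmod (w - z); have := ler_normD (complex.Re (w - z)) (complex.Re z).
    have -> : complex.Re (w - z) + complex.Re z = complex.Re w.
      by case: w z {wz zRe zIm} => ? ? [? ?] /=; rewrite subrK.
    by rewrite /s in wz zRe zIm *; lra.
  have := Im_le_cmod (w - z); have := ler_normD (complex.Im (w - z)) (complex.Im z).
  have -> : complex.Im (w - z) + complex.Im z = complex.Im w.
    by case: w z {wz zRe zIm} => ? ? [? ?] /=; rewrite subrK.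
  by rewrite /s in wz zRe zIm *; lra.
have dFc : differentiable (F \o clamp t) 0.
  apply: (removable_on_square s0 cFc) => z zRe zIm z0.
  have zRe' : `|complex.Re z| <= s by rewrite ler_norml.
  have zIm' : `|complex.Im z| <= s by rewrite ler_norml.
  apply: near_differentiable (near_id z zRe' zIm') _; apply: dF => //.
  rewrite subr0; apply: le_lt_trans (cmod_le _) _.
  by rewrite /s /t in zRe' zIm'; lra.
apply: near_differentiable dFc.
have : \forall w \near (0 : C), F w = (F \o clamp t) w.
  by apply: near_id; rewrite /= normr0 ltW.
by apply: filterS => w ->.
Qed.

End Removable.

(** * Order at the origin *)
Section Order.
Variable R : realType.
Local Notation C := (CC R).

Lemma holomorphic_divX (h : C -> C) : holomorphic_at h 0 -> h 0 = 0 ->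
  exists2 h1 : C -> C, holomorphic_at h1 0 & forall z, h z = z * h1 z.
Proof.
move=> hh h0; have [l hl] := (differentiableCP h 0).1 (nbhs_singleton hh).
pose h1 (z : C) := if z == 0 then l else h z / z.
have hE z : h z = z * h1 z.
  by rewrite /h1; case: eqVneq => [->|z0]; [rewrite mul0r|rewrite mulrC divfK].
exists h1 => //.
have dh1 : \forall z \near (0 : C), z != 0 -> differentiable h1 z.
  move: hh; rewrite /holomorphic_at; apply: filterS => z hz z0.
  apply: (@near_differentiable _ (h * (fun w : C => w^-1))).
    apply/nearCP; exists (cmod z); first by rewrite cmod_gt0.
    move=> w wz; rewrite /h1; case: eqP => // w0.
    by move: wz; rewrite w0 sub0r cmodN ltxx.
  exact: differentiableM hz (differentiable_Rinv z0).
have ch1 : {for 0, continuous h1}.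
  apply/continuousCP => e e0; have e2 : 0 < e / 2 by rewrite divr_gt0.
  move: (hl _ e2); apply: filterS => z; rewrite h0 !subr0 => hz.
  rewrite {2}/h1 eqxx; have [->|z0] := eqVneq z 0.
    by rewrite /h1 eqxx subrr cmod0.
  have : cmod z * cmod (h1 z - l) <= e / 2 * cmod z.
    by rewrite -cmodM mulrBr -hE [z * l]mulrC.
  rewrite mulrC ler_pM2r ?cmod_gt0// => /le_lt_trans; apply; lra.
have dh0 := removable_singularity ch1 dh1.
rewrite /holomorphic_at; move: dh1; apply: filterS => z dz.
by have [->|/dz] := eqVneq z 0.
Qed.

Lemma near0_neq (P : C -> Prop) : (\forall z \near (0 : C), z != 0 -> P z) ->
  exists2 z : C, z != 0 & P z.
Proof.
move=> /nearCP[d d0 dP]; exists (d / 2)%:C.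
  by rewrite -cmod_gt0 cmod_real normr_gt0 gt_eqF// divr_gt0.
apply: dP; last by rewrite -cmod_gt0 cmod_real normr_gt0 gt_eqF// divr_gt0.
by rewrite subr0 cmod_real gtr0_norm ?divr_gt0//; lra.
Qed.

Lemma near_unique (f g : C -> C) : {for 0, continuous f} -> {for 0, continuous g} ->
  (\forall z \near (0 : C), z != 0 -> f z = g z) -> f 0 = g 0.
Proof.
move=> cf cg fg; apply/eqP; rewrite -subr_eq0 -cmod_eq0; apply/negP => /negP n0.
have e0 : 0 < cmod (f 0 - g 0) / 2 by rewrite divr_gt0// lt_def n0 cmod_ge0.
have /continuousCP/(_ _ e0) := cf; have /continuousCP/(_ _ e0) := cg.
move=> ng nf.
have /near0_neq[z z0 [h1 h2 h3]] : \forall z \near (0 : C), z != 0 ->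
    [/\ cmod (f z - f 0) < cmod (f 0 - g 0) / 2,
        cmod (g z - g 0) < cmod (f 0 - g 0) / 2 & f z = g z].
  near=> z => z0; split; [near: z|near: z|]; [exact: nf|exact: ng|].
  by move: z0; near: z.
have := cmodD (f 0 - f z) (f z - g 0).
by rewrite addrA subrK cmodB h3; rewrite h3 in h1; lra.
Unshelve. all: by end_near. Qed.

Lemma differentiable_exprn (n : nat) (z : C) : differentiable (fun z : C => z ^+ n) z.
Proof.
elim: n => [|n IH].
  rewrite (_ : (fun z : C => z ^+ 0) = (fun=> 1)); first exact: differentiable_cst.
  by apply/funext => w; rewrite expr0.
rewrite (_ : (fun z : C => z ^+ n.+1) = (id : C -> C) * (fun z : C => z ^+ n)).
  by apply: differentiableM => //; exact: ex_diff.
by apply/funext => w; rewrite exprS.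
Qed.

(** By induction on N, the divisibility of z^N: if N > 0 then h or k vanishes at
    0 and is divisible by z. *)
Lemma holomorphic_factor (N : nat) (h k : C -> C) :
  holomorphic_at h 0 -> holomorphic_at k 0 ->
  (\forall z \near (0 : C), z != 0 -> h z * k z = z ^+ N) ->
  exists (a : nat) (u : C -> C), [/\ holomorphic_at u 0, u 0 != 0 &
    forall z, h z = u z * z ^+ a].
Proof.
elim: N h k => [|N IH] h k hh hk hkE.
  have hk0 : h 0 * k 0 = 1.
    apply: (@near_unique (h * k) (fun=> 1)); last exact: hkE.
      have dh := nbhs_singleton hh; have dk := nbhs_singleton hk.
      exact: differentiable_continuous (differentiableM dh dk).
    exact: cst_continuous.
  exists 0%N, h; split=> // [|z]; last by rewrite expr0 mulr1.
  by apply/eqP => h0; move: hk0; rewrite h0 mul0r => /esym/eqP; rewrite oner_eq0.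
have hk0 : h 0 * k 0 = 0.
  have dX : differentiable (fun z : C => z ^+ N.+1) 0.
    exact: differentiable_exprn.
  have dh := nbhs_singleton hh; have dk := nbhs_singleton hk.
  rewrite -[RHS](expr0n C N.+1).
  exact: (near_unique (differentiable_continuous (differentiableM dh dk))
    (differentiable_continuous dX) hkE).
move/eqP: hk0; rewrite mulf_eq0 => /orP[/eqP h0|/eqP k0].
  have [h1 hh1 hE] := holomorphic_divX hh h0.
  have [|a [u [hu u0 uE]]] := IH h1 k hh1 hk.
    move: hkE; apply: filterS => z + z0 => /(_ z0).
    by rewrite hE -mulrA exprS => /(mulfI z0).
  by exists a.+1, u; split=> // z; rewrite hE uE mulrCA exprS.
have [k1 hk1 kE] := holomorphic_divX hk k0.
apply: (IH h k1) => //; move: hkE; apply: filterS => z + z0 => /(_ z0).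
by rewrite kE mulrCA exprS => /(mulfI z0).
Qed.

(** If the unit is h/z^n and its inverse k/z^m, then h k = z^(n + m). *)
Lemma mero_unit_order (V : opens C) (f : mero_unit V) : open_set V 0 ->
  exists (a : int) (u : C -> C), [/\ holomorphic_at u 0, u 0 != 0 &
    \forall w \near (0 : C), forall w' : (V `\ 0 : set C),
      \val w' = w -> f w' = u w * w ^ a].
Proof.
move=> V0; have [[_ /(_ V0)[n [h [hh fh]]]] [g [_ /(_ V0)[m [k [hk gk]]]] fg]] := mero_unitP f.
have Vn : \forall w \near (0 : C), open_set V w.
  by apply: open_nbhs_nbhs; split=> //; exact: openP.
have [|a [u [hu u0 uE]]] := @holomorphic_factor (n + m) h k hh hk.
  near=> w => w0.
  have Vw : open_set V w by near: w.
  have Vw0 : (V `\ 0) w by split=> //; exact/eqP.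
  pose w' : (V `\ 0 : set C) := SigSub (mem_set Vw0).
  have fw : forall z : (V `\ 0 : set C), \val z = w -> f z = h w / w ^+ n by near: w.
  have gw : forall z : (V `\ 0 : set C), \val z = w -> g z = k w / w ^+ m by near: w.
  have := fg w'; rewrite (fw w' erefl) (gw w' erefl) mulrACA -invfM -exprD => /divr1_eq; exact.
exists (a%:Z - n%:Z), u; split=> //.
move: fh; apply: filterS => w fw w' ww'; rewrite fw// uE.
have w0 : w != 0 by rewrite -ww'; apply/eqP; exact: (set_valP w').2.
by rewrite expfzDr// -mulrA exprnN.
Unshelve. all: by end_near. Qed.

End Order.

(** * The multiplier of an automorphism *)
Section Coordinate.
Variable R : realType.
Local Notation C := (CC R).
Implicit Types (U V : opens C) (m : M0 R).

(** The coordinate x_0 = x_i z^i on the complement of the fibre over 0, given the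
    value 0 on that fibre, where the formula depends on the chart. *)
Definition fibre_coord m : C :=
  let: (i, (x, y)) := repr m in if x * y == 0 then 0 else x * (x * y) ^ i.

Lemma coord_chart (i : int) (x y : C) : x * y != 0 ->
  fibre_coord (chart i (x, y)) = x * (x * y) ^ i.
Proof.
move=> xy0.
pose f (p : planes R) : C :=
  if p.2.1 * p.2.2 == 0 then 0 else p.2.1 * (p.2.1 * p.2.2) ^ p.1.
have -> m : fibre_coord m = f (repr m) by rewrite /fibre_coord /f; case: (repr m) => ? [].
have -> : x * (x * y) ^ i = f (i, (x, y)) by rewrite /f /= (negbTE xy0).
apply: planes_ind2 (glue_repr _ _).
move=> [j [a b]] q [b0 ->]; rewrite /f /=.
have -> : b^-1 * (b ^+ 2 * a) = a * b by rewrite expr2 -mulrA mulKf// mulrC.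
case: eqVneq => // ab0; rewrite expfzDr// expr1z mulrC [RHS]mulrC -mulrA.
by congr (_ * _); rewrite mulfK.
Qed.

Lemma chart_reindex (i : int) (n : nat) (x y : C) : x * y != 0 ->
  chart i (x, y) = chart (i + n%:Z) (x / (x * y) ^+ n, y * (x * y) ^+ n) :> M0 R.
Proof.
move=> xy0; elim: n => [|n IH]; first by rewrite addr0 expr0 divr1 mulr1.
have xyn : (x * y) ^+ n != 0 by rewrite expf_neq0.
have [x0 y0] : x != 0 /\ y != 0 by move: xy0; rewrite mulf_eq0 negb_or => /andP.
rewrite IH chart_glue ?mulf_neq0// -addrA -PoszD addn1 ![(x * y) ^+ n.+1]exprS.
move: xyn; set P := _ ^+ n => xyn.
by congr (chart _ (_, _)); field; rewrite ?x0 ?y0 ?xyn.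
Qed.

Lemma chart_reindexz (i d : int) (x y : C) : x * y != 0 ->
  chart i (x, y) = chart (i + d) (x / (x * y) ^ d, y * (x * y) ^ d) :> M0 R.
Proof.
move=> xy0; case: d => n; first exact: chart_reindex.
have xyn : (x * y) ^+ n.+1 != 0 by rewrite expf_neq0.
rewrite NegzE -exprnN invrK [RHS](chart_reindex _ n.+1).
  have -> : x * (x * y) ^+ n.+1 * (y / (x * y) ^+ n.+1) = x * y.
    by rewrite mulrACA mulfV// mulr1.
  by rewrite addrNK mulfK// divfK.
by rewrite mulrACA mulfV// mulr1.
Qed.

(** Off the fibre over 0, chart 0 covers everything. *)
Lemma chart_coord m : pi0 m != 0 -> m = chart 0 (fibre_coord m, pi0 m / fibre_coord m).
Proof.
have [i [[x y] ->]] := chart_surj m; rewrite pi0_chart => xy0.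
have x0 : x != 0 by move: xy0; rewrite mulf_eq0 negb_or => /andP[].
have xyi : (x * y) ^ i != 0 by rewrite expfz_neq0.
rewrite coord_chart// (chart_reindexz i (- i) xy0) subrr.
rewrite -[(x * y) ^ (- i)]invr_expz invrK.
move: xyi; set P := _ ^ i => xyi.
by congr (chart _ (_, _)); field; rewrite x0 xyi.
Qed.

Lemma coord_inj m m' : pi0 m != 0 -> pi0 m = pi0 m' -> fibre_coord m = fibre_coord m' -> m = m'.
Proof.
move=> m0 mm cc; rewrite (chart_coord m0) mm cc -chart_coord//.
by rewrite -mm.
Qed.

Lemma coord_neq0 m : pi0 m != 0 -> fibre_coord m != 0.
Proof.
have [i [[x y] ->]] := chart_surj m; rewrite pi0_chart => xy0.
rewrite coord_chart// mulf_neq0// ?expfz_neq0//.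
by move: xy0; rewrite mulf_eq0 negb_or => /andP[].
Qed.

Lemma coord_act (l : C) m : l != 0 -> pi0 m != 0 -> fibre_coord (act l m) = l * fibre_coord m.
Proof.
have [i [[x y] ->]] := chart_surj m; rewrite pi0_chart => l0 xy0.
have E : l * x * (l^-1 * y) = x * y by rewrite mulrACA mulfV// mul1r.
by rewrite act_chart// !coord_chart ?E// mulrA.
Qed.

(** The point x_0 = 1 over z.  This section of pi0 is defined over z = 0 as well,
    where it meets the fibre at a point with trivial stabiliser. *)
Definition unit_point (z : C) : M0 R := chart 0 (1, z).

Lemma pi0_unit_point z : pi0 (unit_point z) = z.
Proof. by rewrite pi0_chart mul1r. Qed.

Lemma coord_unit_point z : z != 0 -> fibre_coord (unit_point z) = 1.
Proof. by move=> z0; rewrite coord_chart ?mul1r// expr0z. Qed.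

Lemma unit_point_mem V z : open_set V z -> (@pi0 R @^-1` V) (unit_point z).
Proof. by move=> Vz; rewrite /= pi0_unit_point. Qed.

Definition unit_pt V (z : C) (Vz : open_set V z) : (@pi0 R @^-1` V : set (M0 R)) :=
  SigSub (mem_set (unit_point_mem Vz)).

Lemma punct_mem V (z : (V `\ 0 : set C)) : open_set V (\val z).
Proof. exact: (set_valP z).1. Qed.

Lemma punct_neq0 V (z : (V `\ 0 : set C)) : \val z != 0.
Proof. by apply/eqP; exact: (set_valP z).2. Qed.

(** The function phi such that f multiplies x_0 by phi(z); see [autE]. *)
Definition multiplier V (f : (@pi0 R @^-1` V : set (M0 R)) -> (@pi0 R @^-1` V : set (M0 R)))
    (z : (V `\ 0 : set C)) : C :=
  fibre_coord (\val (f (unit_pt (punct_mem z)))).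

(** The point m is obtained by the action of x_0(m) from the point x_0 = 1 over
    the same z, and f commutes with the action. *)
Lemma autE V (f : aut V) (m : (@pi0 R @^-1` V : set (M0 R))) (z : (V `\ 0 : set C)) :
  pi0 (\val m) = \val z -> \val (f m) = act (multiplier f z) (\val m).
Proof.
move=> mz; have z0 := punct_neq0 z.
have m0 : pi0 (\val m) != 0 by rewrite mz.
have [_ ef of_] := autP f.
have c0 := coord_neq0 m0.
have fm0 (a : (@pi0 R @^-1` V : set (M0 R))) : pi0 (\val a) != 0 -> pi0 (\val (f a)) != 0.
  by rewrite of_.
have ptz : pi0 (\val (unit_pt (punct_mem z))) = \val z by rewrite /= pi0_unit_point.
have pt0 : pi0 (\val (unit_pt (punct_mem z))) != 0 by rewrite ptz.
have mE : \val m = act (fibre_coord (\val m)) (\val (unit_pt (punct_mem z))).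
  apply: coord_inj => //; first by rewrite pi0_act// mz ptz.
  by rewrite coord_act// coord_unit_point ?mulr1.
have phi0 : multiplier f z != 0 by apply: coord_neq0; exact: fm0.
rewrite (ef _ _ _ c0 mE).
apply: coord_inj; rewrite ?pi0_act ?of_ ?ptz ?mz//.
by rewrite !coord_act ?of_ ?ptz// mulrC.
Qed.

Lemma multiplier_neq0 V (f : aut V) z : multiplier f z != 0.
Proof.
apply: coord_neq0; have [_ _ ->] := autP f.
by rewrite /= pi0_unit_point punct_neq0.
Qed.

Lemma multiplierM V (f g : aut V) z :
  multiplier (f * g)%g z = multiplier f z * multiplier g z.
Proof.
rewrite {1}/multiplier /= (@autE V f _ z).
  rewrite coord_act ?multiplier_neq0//.
  by have [_ _ ->] := autP g; rewrite /= pi0_unit_point punct_neq0.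
by have [_ _ ->] := autP g; rewrite /= pi0_unit_point.
Qed.

Lemma multiplier1 V z : multiplier (1%g : aut V) z = 1.
Proof. by rewrite /multiplier /= coord_unit_point// punct_neq0. Qed.

Lemma differentiable_exprz (n : int) (z : C) : z != 0 ->
  differentiable (fun w : C => w ^ n) z.
Proof.
move=> z0; case: n => n; first exact: differentiable_exprn.
have zn : z ^+ n.+1 != 0 by rewrite expf_neq0.
exact: differentiableV (@differentiable_exprn R n.+1 z) zn.
Qed.

Lemma differentiable_fst (p : C * C) : differentiable (fst : C * C -> C) p.
Proof. by apply: (@linear_differentiable _ _ _ (fst : {linear _ -> _})) => q; exact: cvg_fst. Qed.

Lemma differentiable_snd (p : C * C) : differentiable (snd : C * C -> C) p.
Proof. by apply: (@linear_differentiable _ _ _ (snd : {linear _ -> _})) => q; exact: cvg_snd. Qed.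

(** In charts, f maps (1, w) in chart 0 to g(1, w) in some chart j, and the
    coordinate x_0 of the latter is its first component times w^j. *)
Lemma multiplier_local V (f : aut V) (z0 : C) : open_set V z0 ->
  exists (j : int) (h : C -> C), holomorphic_at h z0 /\
    \forall w \near z0, forall w' : (V `\ 0 : set C),
      \val w' = w -> multiplier f w' = h w * w ^ j.
Proof.
move=> Vz; have [[hf _] _ of_] := autP f.
have [j [g [hg fg]]] := hf (unit_pt Vz) 0 (1, z0) erefl.
pose i1 (w : C) : C * C := (1, w).
have hi : holomorphic_at i1 z0.
  near=> w; apply: differentiable_pair; first exact: differentiable_cst.
  exact: ex_diff.
exists j, (fst \o (g \o i1)); split.
  apply: holomorphic_at_comp (holomorphic_at_comp hi hg) _.
  by near=> w; exact: differentiable_fst.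
have := holomorphic_at_near hi fg; apply: filterS => w gw w' ww'.
have E : \val (f (unit_pt (punct_mem w'))) = chart j (g (i1 w)).
  by apply: gw; rewrite /= -ww'.
have w0 := punct_neq0 w'; rewrite ww' in w0.
have pE : pi0 (chart j (g (i1 w))) = w.
  by rewrite -E of_ /= pi0_unit_point.
rewrite /multiplier E /=; case: (g (i1 w)) pE => x y; rewrite pi0_chart /= => xy.
by rewrite coord_chart xy.
Unshelve. all: by end_near. Qed.

Lemma multiplier_meromorphic V (f : aut V) : meromorphic (multiplier f).
Proof.
split=> [z|V0].
  have [j [h [hh fh]]] := multiplier_local f (punct_mem z).
  exists (h * (fun w => w ^ j)).
    have zn : \forall w \near \val z, w != 0.
      have z0 := punct_neq0 z; rewrite -cmod_gt0 in z0.
      apply/nearCP; exists (cmod (\val z)) => // w.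
      by apply: contraTneq => ->; rewrite sub0r cmodN ltxx.
    move: hh zn; apply: filterS2 => w hw w0.
    exact: differentiableM hw (differentiable_exprz j w0).
  exact: fh.
have [j [h [hh fh]]] := multiplier_local f V0.
case: j fh => n fh.
  exists 0%N, (h * (fun w => w ^+ n)); split.
    move: hh; apply: filterS => w hw.
    exact: differentiableM hw (differentiable_exprn n w).
  by move: fh; apply: filterS => w fw w' ww'; rewrite fw// expr0 divr1.
exists n.+1, h; split=> //.
Qed.

Lemma multiplier_unit V (f : aut V) : meromorphic_unit (multiplier f).
Proof.
split; first exact: multiplier_meromorphic.
exists (multiplier (f^-1)%g) => [|z]; first exact: multiplier_meromorphic.
by rewrite -multiplierM mulgV multiplier1.
Qed.

Definition aut_multiplier V (f : aut V) : mero_unit V := MeroUnit (multiplier_unit f).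

End Coordinate.

(** * Separation of points of the surface *)
Section Hausdorff.
Variable R : realType.
Local Notation C := (CC R).

Lemma diagonal_near (p : C * C) (P : C * C -> Prop) :
  (\forall q \near p, P q) -> \forall t \near (0 : C), P (p.1 + t, p.2 + t).
Proof.
move=> nP; have c : {for 0, continuous (fun t : C => (p.1 + t, p.2 + t))}.
  apply: differentiable_continuous; apply: differentiable_pair;
    by apply: differentiableD; [exact: differentiable_cst|exact: ex_diff].
by apply: c; rewrite !addr0 -surjective_pairing.
Qed.

Lemma diagonal_generic (p : C * C) :
  \forall t \near (0 : C), t != 0 -> (p.1 + t) * (p.2 + t) != 0.
Proof.
have one (x : C) : \forall t \near (0 : C), t != 0 -> x + t != 0.
  have [->|x0] := eqVneq x 0; first by near=> t; rewrite add0r.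
  apply/nearCP; exists (cmod x); first by rewrite cmod_gt0.
  move=> t + _; rewrite subr0; apply: contraTneq => /eqP.
  by rewrite addrC addr_eq0 => /eqP ->; rewrite cmodN ltxx.
move: (one p.1) (one p.2); apply: filterS2 => t h1 h2 t0.
by rewrite mulf_neq0 ?h1 ?h2.
Unshelve. all: by end_near. Qed.

(** The points q with q.1 q.2 <> 0 accumulate at p already on the line p + (t, t). *)
Lemma generic_unique (A B : C * C -> C) (p : C * C) :
  {for p, continuous A} -> {for p, continuous B} ->
  (\forall q \near p, q.1 * q.2 != 0 -> A q = B q) -> A p = B p.
Proof.
move=> cA cB AB; pose L (t : C) : C * C := (p.1 + t, p.2 + t).
have L0 : L 0 = p by rewrite /L !addr0 -surjective_pairing.
have cL : {for 0, continuous L}.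
  apply: differentiable_continuous; apply: differentiable_pair;
    by apply: differentiableD; [exact: differentiable_cst|exact: ex_diff].
rewrite -L0 in cA cB; rewrite -L0.
apply: (near_unique (continuous_comp cL cA) (continuous_comp cL cB)).
move: (diagonal_near AB) (diagonal_generic p); apply: filterS2 => t h1 h2 t0.
exact/h1/h2.
Qed.

Lemma chart_inj (i : int) (x y x' y' : C) : x * y != 0 ->
  chart i (x, y) = chart i (x', y') :> M0 R -> x = x' /\ y = y'.
Proof.
move=> xy0 e; have xyE : x * y = x' * y'.
  by have := congr1 (@pi0 R) e; rewrite !pi0_chart.
have := congr1 (@fibre_coord R) e; rewrite !coord_chart -?xyE//.
move=> /(mulIf (expfz_neq0 i xy0)) xx; split=> //.
move: xyE xy0; rewrite -xx mulf_eq0 negb_or => + /andP[x0 _].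
exact: mulfI.
Qed.

(** M0 is Hausdorff: two continuous maps into the charts j and j' that agree over
    z <> 0 agree at p.  Let j' = j + n and p lie over z = 0.  From g1 = g1' z^n and
    g2' = g2 z^n one gets g1' g2 z^(n - 1) = 1 for z <> 0 if n > 0.  This excludes n > 1
    in the limit, and for n = 1 says that g1' and g2 are inverse, so that the points
    (0, g2) and (g1', 0) of neighbouring charts are glued. *)
Lemma chart_separated (p : C * C) (g g' : C * C -> C * C) (j j' : int) :
  {for p, continuous g} -> {for p, continuous g'} ->
  (\forall q \near p, q.1 * q.2 != 0 -> chart j (g q) = chart j' (g' q) :> M0 R /\
     (g q).1 * (g q).2 = q.1 * q.2) ->
  chart j (g p) = chart j' (g' p) :> M0 R.
Proof.
wlog jj' : j j' g g' / exists n : nat, j' = j + n%:Z.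
  move=> wl cg cg' gg'; have [jj|jj] := leP j j'.
    by apply: wl => //; exists `|j' - j|%N; rewrite gez0_abs ?subr_ge0// addrCA subrr addr0.
  apply/esym/wl => //.
    by exists `|j - j'|%N; rewrite gez0_abs ?subr_ge0 1?ltW// addrCA subrr addr0.
  move: gg'; apply: filterS => q h /h[e1 e2]; split; first by rewrite e1.
  have := congr1 (@pi0 R) e1; rewrite [g q]surjective_pairing [g' q]surjective_pairing.
  by rewrite !pi0_chart => <-.
case: jj' => n ->; move=> cg cg' gg'.
have [pz|pz] := eqVneq (p.1 * p.2) 0; last by have [] := nbhs_singleton gg' pz.
pose z (q : C * C) := q.1 * q.2.
have cfst (f : C * C -> C * C) : {for p, continuous f} -> {for p, continuous (fst \o f)}.
  by move=> cf; exact: continuous_comp cf (differentiable_continuous (differentiable_fst (f p))).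
have csnd (f : C * C -> C * C) : {for p, continuous f} -> {for p, continuous (snd \o f)}.
  by move=> cf; exact: continuous_comp cf (differentiable_continuous (differentiable_snd (f p))).
have dz : differentiable z p.
  exact: differentiableM (differentiable_fst p) (differentiable_snd p).
have cz := differentiable_continuous dz.
have czn_ k : {for p, continuous (fun q => z q ^+ k)}.
  exact: continuous_comp cz (differentiable_continuous (@differentiable_exprn R k (z p))).
have rel : \forall q \near p, z q != 0 ->
    [/\ (g' q).1 * z q ^+ n = (g q).1, (g' q).2 = (g q).2 * z q ^+ n &
        (g q).1 * (g q).2 = z q].
  move: gg'; apply: filterS => q h z0; have [e1 e2] := h z0.
  have zn : z q ^+ n != 0 by rewrite expf_neq0.
  rewrite [g q]surjective_pairing [g' q]surjective_pairing in e1.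
  rewrite (chart_reindex _ n) e2// -/(z q) in e1.
  have [|<- <-] := chart_inj _ e1; first by rewrite mulrACA mulVf// mulr1 e2.
  by rewrite divfK.
have cg1' := cfst _ cg'; have cg2' := csnd _ cg'.
have cg1 := cfst _ cg; have cg2 := csnd _ cg.
have E1 : (g' p).1 * z p ^+ n = (g p).1.
  apply: (generic_unique (continuousM cg1' (czn_ n)) cg1).
  by move: rel; apply: filterS => q h /h[].
have E2 : (g' p).2 = (g p).2 * z p ^+ n.
  apply: (generic_unique cg2' (continuousM cg2 (czn_ n))).
  by move: rel; apply: filterS => q h /h[].
rewrite [g p]surjective_pairing [g' p]surjective_pairing E2 -E1.
case: n => [|n] in gg' rel E1 E2 *; first by rewrite addr0 expr0 !mulr1.
rewrite {1 2}/z pz expr0n /= !mulr0.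
have E3 : (g' p).1 * z p ^+ n * (g p).2 = 1.
  apply: (generic_unique (continuousM (continuousM cg1' (czn_ n)) cg2)
    (@cst_continuous _ _ (1 : C) p)).
  move: rel; apply: filterS => q h z0; have [h1 _ h3] := h z0.
  suff : (g' q).1 * z q ^+ n * (g q).2 = 1 by [].
  apply: (@mulfI _ (z q) z0); rewrite mulr1; apply: etrans h3; rewrite -h1 exprS.
  by move: (z q) => w; ring.
case: n => [|n] in gg' rel E1 E2 E3 *; last first.
  by move: E3; rewrite {1}/z pz expr0n /= mulr0 mul0r => /esym/eqP; rewrite oner_eq0.
rewrite expr0 mulr1 in E3.
have g20 : (g p).2 != 0 by apply: contra_eqN E3 => /eqP ->; rewrite mulr0 eq_sym oner_eq0.
rewrite chart_glue// mulr0; congr (chart _ (_, _)).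
by rewrite -[RHS]mulr1 -(mulfV g20) mulrA E3 mul1r.
Qed.



End Hausdorff.

(** * The automorphism with a given multiplier *)
Section Isomorphism.
Variable R : realType.
Local Notation C := (CC R).
Implicit Types (U V : opens C) (m : M0 R).
Local Notation tube V := (@pi0 R @^-1` V : set (M0 R)).

Lemma chart_tube V i (p : C * C) : (tube V) (chart i p) ->
  \forall q \near p, (tube V) (chart i q).
Proof.
move=> Vp; apply: (@pi0_chart_continuous R i p); apply: open_nbhs_nbhs.
by split; [exact: openP|exact: Vp].
Qed.

(** By [autE] the multiplier determines an automorphism off the fibre over 0, and
    by [chart_separated] it does so everywhere. *)
Lemma aut_multiplier_inj V : injective (@aut_multiplier R V).
Proof.
move=> f f' ff'; have mff' z : multiplier f z = multiplier f' z.
  exact: (congr1 (fun u : mero_unit V => u z) ff').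
have generic (m : tube V) : pi0 (\val m) != 0 -> \val (f m) = \val (f' m).
  move=> m0; have Vm : (V `\ 0) (pi0 (\val m)).
    by split; [exact: (set_valP m)|exact/eqP].
  pose z : (V `\ 0 : set C) := SigSub (mem_set Vm).
  by rewrite !(@autE _ _ _ m z)// mff'.
apply: aut_ext => m; apply: val_inj.
have [i [[x y] mE]] := chart_surj (\val m).
have [[hf _] _ of_] := autP f; have [[hf' _] _ of'] := autP f'.
have [j [g [hg fg]]] := hf m i (x, y) mE.
have [j' [g' [hg' fg']]] := hf' m i (x, y) mE.
have Vp : (tube V) (chart i (x, y)) by rewrite -mE; exact: (set_valP m).
rewrite (nbhs_singleton fg _ mE) (nbhs_singleton fg' _ mE).
apply: chart_separated.
- exact: differentiable_continuous (nbhs_singleton hg).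
- exact: differentiable_continuous (nbhs_singleton hg').
near=> q => q0.
have Vq : (tube V) (chart i q) by near: q; exact: chart_tube.
pose b : tube V := SigSub (mem_set Vq).
have fb : forall b : tube V, \val b = chart i q -> \val (f b) = chart j (g q) by near: q.
have fb' : forall b : tube V, \val b = chart i q -> \val (f' b) = chart j' (g' q) by near: q.
have pb : pi0 (\val b) = q.1 * q.2 by rewrite /= [q]surjective_pairing pi0_chart.
split; first by rewrite -(fb b erefl) -(fb' b erefl) generic// pb.
by have := of_ b; rewrite (fb b erefl) pb [g q]surjective_pairing pi0_chart.
Unshelve. all: by end_near. Qed.

(** Sends the i-th plane to the (i + a)-th one; on the fibre over 0, a chain of
    projective lines, this is a translation by a steps. *)
Definition shift (a : int) m : M0 R := let: (i, p) := repr m in chart (i + a) p.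

Lemma shift_chart a i p : shift a (chart i p) = chart (i + a) p.
Proof.
pose f (p : planes R) := chart (p.1 + a) p.2.
have -> m : shift a m = f (repr m) by rewrite /shift /f; case: (repr m).
rewrite -[RHS]/(f (i, p)); apply: planes_ind2 (glue_repr _ _).
by move=> [j [x y]] q [b0 ->]; rewrite /f /= chart_glue// addrAC.
Qed.

Lemma pi0_shift a m : pi0 (shift a m) = pi0 m.
Proof. by have [i [[x y] ->]] := chart_surj m; rewrite shift_chart !pi0_chart. Qed.

Lemma act_shift a l m : l != 0 -> act l (shift a m) = shift a (act l m).
Proof.
move=> l0; have [i [[x y] ->]] := chart_surj m.
by rewrite shift_chart !act_chart// shift_chart.
Qed.

Lemma shiftK a m : shift (- a) (shift a m) = m.
Proof. by have [i [p ->]] := chart_surj m; rewrite !shift_chart addrK. Qed.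

Lemma actC k l m : k != 0 -> l != 0 -> act k (act l m) = act l (act k m).
Proof. by move=> k0 l0; rewrite -!actM// mulrC. Qed.

(** This is why a power of z in the multiplier does no harm at z = 0: the
    right-hand side is defined on the fibre over 0 as well. *)
Lemma act_exprz a m : pi0 m != 0 -> act (pi0 m ^ a) m = shift a m.
Proof.
have [i [[x y] ->]] := chart_surj m; rewrite pi0_chart => xy0.
have xya : (x * y) ^ a != 0 by rewrite expfz_neq0.
have E : (x * y) ^ a * x * (((x * y) ^ a)^-1 * y) = x * y.
  by rewrite mulrACA mulfV// mul1r.
rewrite act_chart// shift_chart (chart_reindexz i a) ?E//.
by congr (chart _ (_, _)); [rewrite mulrAC mulfV// mul1r|rewrite mulrAC mulVf// mul1r].
Qed.

(** The value 1 outside the domain keeps the function invertible everywhere. *)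
Definition punct_ext V (u : mero_unit V) (z : C) : C :=
  if pselect ((V `\ 0) z) is left Vz then u (SigSub (mem_set Vz)) else 1.

Lemma punct_extE V (u : mero_unit V) (z : (V `\ 0 : set C)) : punct_ext u (\val z) = u z.
Proof.
rewrite /punct_ext; case: pselect => [Vz|/(_ (set_valP z))//].
by congr (mero_fun u _); exact: val_inj.
Qed.

Lemma punct_ext_neq0 V (u : mero_unit V) z : punct_ext u z != 0.
Proof.
rewrite /punct_ext; case: pselect => [Vz|_]; [exact: mero_unit_neq0|exact: oner_neq0].
Qed.

(** The expansion u = v z^a at 0.  If 0 is not in V, only v(0) <> 0 is asked, so
    that [twist] below makes sense in all cases. *)
Definition germ V (u : mero_unit V) (a : int) (v : C -> C) :=
  v 0 != 0 /\ (open_set V 0 -> holomorphic_at v 0 /\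
    \forall w \near (0 : C), forall w' : (V `\ 0 : set C),
      \val w' = w -> u w' = v w * w ^ a).

Lemma germ_exists V (u : mero_unit V) : exists a v, germ u a v.
Proof.
have [V0|V0] := pselect (open_set V 0); last first.
  by exists 0, (fun=> 1); split; [exact: oner_neq0|].
by have [a [v [hv v0 uv]]] := mero_unit_order u V0; exists a, v.
Qed.

Lemma holomorphic_inv (v : C -> C) (z : C) : holomorphic_at v z -> v z != 0 ->
  holomorphic_at (fun w => (v w)^-1) z /\ \forall w \near z, v w != 0.
Proof.
move=> hv v0; have cv := differentiable_continuous (nbhs_singleton hv).
have vn : \forall w \near z, v w != 0.
  have e0 : 0 < cmod (v z) by rewrite cmod_gt0.
  have /continuousCP/(_ _ e0) := cv; apply: filterS => w.
  by apply: contraTneq => ->; rewrite sub0r cmodN ltxx.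
split=> //; move: hv vn; rewrite /holomorphic_at; apply: filterS2 => w hw w0.
exact: differentiableV hw w0.
Qed.

Lemma germV V (u : mero_unit V) a v : germ u a v ->
  germ (u^-1)%g (- a) (fun w => (v w)^-1).
Proof.
move=> [v0 uv]; split; first by rewrite invr_eq0.
move=> V0; have [hv {}uv] := uv V0; have [hv' vn] := holomorphic_inv hv v0; split=> //.
move: uv; apply: filterS => w uw w' ww'.
by rewrite -[LHS]/((u w')^-1) uw// invfM invr_expz.
Qed.

(** Multiplication of x_0 by u, extended over z = 0 by means of u = v z^a and
    [act_exprz]. *)
Definition twist V (u : mero_unit V) (a : int) (v : C -> C) m : M0 R :=
  if pi0 m == 0 then act (v 0) (shift a m) else act (punct_ext u (pi0 m)) m.

Section Twist.
Variables (V : opens C) (u : mero_unit V) (a : int) (v : C -> C).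
Hypothesis uv : germ u a v.

Lemma pi0_twist m : pi0 (twist u a v m) = pi0 m.
Proof.
rewrite /twist; case: ifP => _; rewrite pi0_act ?pi0_shift ?punct_ext_neq0//.
by case: uv.
Qed.

Lemma twist_act l m : l != 0 -> twist u a v (act l m) = act l (twist u a v m).
Proof.
move=> l0; rewrite /twist pi0_act//; case: ifP => _.
  by rewrite -act_shift// actC//; case: uv.
by rewrite actC// punct_ext_neq0.
Qed.

(** Over 0 one takes h = v and j = i + a; elsewhere h is a local expression of u
    and j = i. *)
Lemma twist_local i (p : C * C) : (tube V) (chart i p) ->
  exists (j : int) (h : C -> C), [/\ holomorphic_at h (p.1 * p.2), h (p.1 * p.2) != 0 &
    \forall q \near p, twist u a v (chart i q) =
      chart j (h (q.1 * q.2) * q.1, (h (q.1 * q.2))^-1 * q.2)].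
Proof.
case: p => x y; rewrite /= pi0_chart => Vxy; have [v0 uv0] := uv.
pose prod (q : C * C) : C := q.1 * q.2.
have hprod : holomorphic_at prod (x, y).
  near=> q; exact: differentiableM (differentiable_fst q) (differentiable_snd q).
have near_prod (P : C -> Prop) : (\forall z \near x * y, P z) ->
    \forall q \near (x, y), P (q.1 * q.2).
  exact: (holomorphic_at_near hprod).
have Vn : \forall z \near x * y, open_set V z.
  by apply: open_nbhs_nbhs; split=> //; exact: openP.
have [z0|z0] := eqVneq (x * y) 0.
  rewrite z0 in Vxy Vn *.
  have [hv uw] := uv0 Vxy; have [_ vn] := holomorphic_inv hv v0.
  exists (i + a), v; split=> //.
  have nP : \forall z \near x * y, [/\ open_set V z, v z != 0 & forall w' : (V `\ 0 : set C),
      \val w' = z -> u w' = v z * z ^ a].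
    by rewrite z0; near=> z; split; near: z.
  move: (near_prod _ nP); apply: filterS => -[x' y'] /= [Vz vz uz].
  rewrite /twist pi0_chart; case: eqVneq => [->|xy0]; first by rewrite shift_chart act_chart.
  have Vz0 : (V `\ 0) (x' * y') by split=> //; exact/eqP.
  pose w : (V `\ 0 : set C) := SigSub (mem_set Vz0).
  have -> : punct_ext u (x' * y') = v (x' * y') * (x' * y') ^ a.
    exact: etrans (punct_extE u w) (uz w erefl).
  rewrite actM ?expfz_neq0//.
  have := @act_exprz a (chart i (x', y')); rewrite pi0_chart => -> //.
  by rewrite shift_chart act_chart.
have Vz0 : (V `\ 0) (x * y) by split=> //; exact/eqP.
pose zz : (V `\ 0 : set C) := SigSub (mem_set Vz0).
have [[um _] _] := mero_unitP u; have [g hg ug] := um zz.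
have nz : \forall z \near x * y, z != 0.
  apply/nearCP; exists (cmod (x * y)); first by rewrite cmod_gt0.
  by move=> w; apply: contraTneq => ->; rewrite sub0r cmodN ltxx.
exists i, g; split=> //.
  by rewrite /= -(nbhs_singleton ug zz erefl) mero_unit_neq0.
have nP : \forall z \near x * y, [/\ open_set V z, z != 0 & forall w' : (V `\ 0 : set C),
    \val w' = z -> u w' = g z].
  by near=> z; split; near: z.
move: (near_prod _ nP); apply: filterS => -[x' y'] /= [Vz zn uz].
rewrite /twist pi0_chart (negbTE zn).
have Vz' : (V `\ 0) (x' * y') by split=> //; exact/eqP.
have E : punct_ext u (x' * y') = g (x' * y').
  pose w : (V `\ 0 : set C) := SigSub (mem_set Vz').
  exact: etrans (punct_extE u w) (uz w erefl).
by rewrite act_chart ?punct_ext_neq0// E.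
Unshelve. all: by end_near. Qed.

Lemma twist_tube (m : tube V) : (tube V) (twist u a v (\val m)).
Proof. by rewrite /= pi0_twist; exact: (set_valP m). Qed.

Definition twist_fun (m : tube V) : tube V := SigSub (mem_set (twist_tube m)).

Lemma twist_holomorphic : holomorphicM0 twist_fun.
Proof.
move=> m i p mp; have Vp : (tube V) (chart i p) by rewrite -mp; exact: (set_valP m).
have [j [h [hh h0 hE]]] := twist_local Vp.
pose prod (q : C * C) : C := q.1 * q.2.
exists j, (fun q => (h (prod q) * q.1, (h (prod q))^-1 * q.2)); split; last first.
  by move: hE; apply: filterS => q hq b bq /=; rewrite bq.
have dprod q : differentiable prod q.
  exact: differentiableM (differentiable_fst q) (differentiable_snd q).
have hprod : holomorphic_at prod p by near=> q; exact: dprod.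
have [hi _] := holomorphic_inv hh h0.
have h1 := holomorphic_at_comp hprod hh; have h2 := holomorphic_at_comp hprod hi.
move: h1 h2; rewrite /holomorphic_at; apply: filterS2 => q d1 d2.
apply: differentiable_pair.
  exact: differentiableM d1 (differentiable_fst q).
exact: differentiableM d2 (differentiable_snd q).
Unshelve. all: by end_near. Qed.

End Twist.

Lemma twistK V (u : mero_unit V) a v (uv : germ u a v) m : (tube V) m ->
  twist (u^-1)%g (- a) (fun w => (v w)^-1) (twist u a v m) = m.
Proof.
move=> Vm; have [v0 _] := uv; rewrite {1}/twist pi0_twist//; case: ifP => m0.
  rewrite /twist m0 act_shift ?invr_eq0// -actM ?invr_eq0// mulVf// act1.
  exact: shiftK.
rewrite /twist m0 -actM ?punct_ext_neq0//.
have Vz : (V `\ 0) (pi0 m) by split=> //; apply/eqP; rewrite m0.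
rewrite -[pi0 m]/(\val (SigSub (mem_set Vz) : (V `\ 0 : set C))) !punct_extE.
by rewrite mulVf ?act1// mero_unit_neq0.
Qed.

Lemma twistVK V (u : mero_unit V) a v (uv : germ u a v) m : (tube V) m ->
  twist u a v (twist (u^-1)%g (- a) (fun w => (v w)^-1) m) = m.
Proof.
move=> Vm; have := twistK (germV uv) Vm; rewrite invgK opprK.
by rewrite (_ : (fun w => (v w)^-1^-1) = v)//; apply/funext => w; rewrite invrK.
Qed.

Lemma twist_is_aut V (u : mero_unit V) a v (uv : germ u a v) : is_aut (twist_fun uv).
Proof.
split.
- split; first exact: twist_holomorphic.
  exists (twist_fun (germV uv)); split; first exact: twist_holomorphic.
    by move=> m; apply: val_inj; apply: twistK => //; exact: (set_valP m).
  by move=> m; apply: val_inj; apply: twistVK => //; exact: (set_valP m).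
- by move=> l m m' l0 mm' /=; rewrite mm' twist_act.
- by move=> m /=; rewrite pi0_twist.
Qed.

Lemma aut_multiplier_surj V (u : mero_unit V) : exists f : aut V, aut_multiplier f = u.
Proof.
have [a [v uv]] := germ_exists u; exists (Aut (twist_is_aut uv)).
apply: mero_unit_ext => z; have z0 := punct_neq0 z.
rewrite /= /multiplier /= /twist pi0_unit_point (negbTE z0).
rewrite coord_act ?pi0_unit_point ?punct_ext_neq0// coord_unit_point// mulr1.
exact: punct_extE.
Qed.

Lemma aut_multiplier_bij V : bijective (@aut_multiplier R V).
Proof.
pose inv u := projT1 (cid (@aut_multiplier_surj V u)).
have invK : cancel inv (@aut_multiplier R V).
  by move=> u; rewrite /inv; case: cid.
by exists inv => // f; apply: aut_multiplier_inj; rewrite invK.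
Qed.

Lemma aut_multiplierM V : {morph @aut_multiplier R V : f g / (f * g)%g}.
Proof. by move=> f g; apply: mero_unit_ext => z; exact: multiplierM. Qed.

Lemma aut_multiplier_restr U V (UV : U `<=` V) (f : aut V) :
  mero_restr UV (aut_multiplier f) = aut_multiplier (aut_restr UV f).
Proof.
apply: mero_unit_ext => z; rewrite /= /multiplier /=.
by congr (fibre_coord (\val (f _))); exact: val_inj.
Qed.

End Isomorphism.

Theorem theorem3p6 (R : realType) :
  sheaf_isomorphic (aut_sheaf R) (mero_unit_sheaf R).
Proof.
exists (@aut_multiplier R); split.
- exact: aut_multiplierM.
- exact: aut_multiplier_bij.
- exact: aut_multiplier_restr.
Qed.
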